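(* On trees with $n$ vertices, \textsc{Min Edge Deletion Bounded-Density} can be solved in time $O(n^3)$.
   Context: All graphs are finite, simple and undirected. The density of a graph $H$ is $\rho(H)=|E(H)|/|V(H)|$ (the empty graph has density $0$), and $\rho^*(G)=\max_{H\subseteq G}\rho(H)$. For $F\subseteq E(G)$, $G-F$ is the graph obtained by removing the edges in $F$. \textsc{Min Edge Deletion Bounded-Density}: given a graph $G$ and a rational $\tau_\rho\ge 0$, compute a minimum-size set $F\subseteq E(G)$ such that $\rho^*(G-F)\le\tau_\rho$. *)

(* Defs.v *)
From HB Require Import structures.
From mathcomp Require Import all_boot all_order all_algebra.

Set Implicit Arguments.
Unset Strict Implicit.
Unset Printing Implicit Defensive.

Import Order.TTheory GRing.Theory Num.Theory.

(* A graph whose vertices are drawn from a finite type T is a pair (V, E);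
   each edge is a two-element subset of V. *)

Section Graphs.
Variable T : finType.

Definition wf_graph (VE : {set T} * {set {set T}}) : bool :=
  [forall e in VE.2, (e \subset VE.1) && (#|e| == 2)].

Record graph : Type := Graph { graph_val : {set T} * {set {set T}};
                               graphP : wf_graph graph_val }.

HB.instance Definition _ := [isSub for graph_val].
HB.instance Definition _ := [Finite of graph by <:].

Definition vertices (G : graph) : {set T} := (graph_val G).1.
Definition edges (G : graph) : {set {set T}} := (graph_val G).2.

Definition subgraph (H G : graph) : bool :=
  (vertices H \subset vertices G) && (edges H \subset edges G).

Lemma wf_del_edges (G : graph) (F : {set {set T}}) :
  wf_graph (vertices G, edges G :\: F).
Proof.
apply/forall_inP => e /=; rewrite inE => /andP[_ eG].
by move/forall_inP: (graphP G) => /(_ e eG).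
Qed.

Definition del_edges (G : graph) (F : {set {set T}}) : graph :=
  Graph (wf_del_edges G F).

(* 0 for the graph without vertices, since x / 0 = 0 in rat. *)
Definition density (H : graph) : rat := (#|edges H|%:R / #|vertices H|%:R)%R.

(* The unit 0 of the iterated maximum is itself a value in the range: it is
   the density of the empty subgraph. *)
Definition max_density (G : graph) : rat :=
  \big[Order.max/0%R]_(H : graph | subgraph H G) density H.

Definition adj (G : graph) : rel T := fun x y => [set x; y] \in edges G.

Definition connected (G : graph) : Prop :=
  vertices G != set0 /\ {in vertices G &, forall x y, connect (adj G) x y}.

Definition acyclic (G : graph) : Prop :=
  forall s : seq T, 2 < size s -> ~ ucycle (adj G) s.

Definition is_tree (G : graph) : Prop := connected G /\ acyclic G.

Definition bounded_density_deletion (G : graph) (tau : rat)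
    (F : {set {set T}}) : Prop :=
  F \subset edges G /\ (max_density (del_edges G F) <= tau)%R.

Definition min_edge_deletion_bounded_density (G : graph) (tau : rat)
    (F : {set {set T}}) : Prop :=
  bounded_density_deletion G tau F /\
  forall F' : {set {set T}}, bounded_density_deletion G tau F' -> #|F| <= #|F'|.

End Graphs.

(* The random access machine of Cook and Reckhow (Time bounded random access
   machines, 1973), over the natural numbers: subtraction is truncated. The
   memory cells X_0, X_1, ... are initially 0, the input is read from and the
   output written to a sequential tape, and every instruction costs one step.
   There is no multiplication, so that the unit-cost measure is a reasonable
   one: a value grows by at most one bit per step. *)

Inductive instr : Type :=
  | IConst of nat & nat         (* X_i <- c *)
  | IAdd of nat & nat & nat     (* X_i <- X_j + X_k *)
  | ISub of nat & nat & nat     (* X_i <- X_j - X_k *)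
  | ILoad of nat & nat          (* X_i <- X_(X_j) *)
  | IStore of nat & nat         (* X_(X_i) <- X_j *)
  | IJpos of nat & nat          (* if X_j > 0 then go to instruction l *)
  | IRead of nat                (* X_i <- next input number, 0 if none is left *)
  | IPrint of nat.              (* append X_i to the output *)

Definition program := seq instr.

Record state : Type := State { pc : nat;
                               mem : nat -> nat;
                               inp : seq nat;
                               out : seq nat }.

Definition upd (m : nat -> nat) (i v : nat) : nat -> nat :=
  fun a => if a == i then v else m a.

Definition exec (c : instr) (s : state) : state :=
  let: State p m r w := s in
  match c with
  | IConst i v => State p.+1 (upd m i v) r w
  | IAdd i j k => State p.+1 (upd m i (m j + m k)) r w
  | ISub i j k => State p.+1 (upd m i (m j - m k)) r w
  | ILoad i j  => State p.+1 (upd m i (m (m j))) r w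
  | IStore i j => State p.+1 (upd m (m i) (m j)) r w
  | IJpos j l  => State (if 0 < m j then l else p.+1) m r w
  | IRead i    => State p.+1 (upd m i (head 0 r)) (behead r) w
  | IPrint i   => State p.+1 m r (rcons w (m i))
  end.

(* The machine halts when pc points outside the program; such states are fixed
   by step. *)
Definition halted (P : program) (s : state) : bool := size P <= pc s.

Definition step (P : program) (s : state) : state :=
  if onth P (pc s) is Some c then exec c s else s.

Definition init (x : seq nat) : state := State 0 (fun=> 0) x [::].

Definition outputs_within (P : program) (x : seq nat) (t : nat) (y : seq nat)
    : Prop :=
  let s := iter t (step P) (init x) in halted P s /\ out s = y.

Definition bigO (f g : nat -> nat) : Prop :=
  exists c n0 : nat, forall n, n0 <= n -> f n <= c * g n.

Section Encodings.
Variable n : nat.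

(* s lists every edge of F exactly once, in any order and with either order of
   the endpoints. *)
Definition edge_list (F : {set {set 'I_n}}) (s : seq ('I_n * 'I_n)) : Prop :=
  perm_eq [seq [set e.1; e.2] | e <- s] (enum F).

Definition endpoints (s : seq ('I_n * 'I_n)) : seq nat :=
  flatten [seq [:: val e.1; val e.2] | e <- s].

Definition encodes_edges (F : {set {set 'I_n}}) (y : seq nat) : Prop :=
  exists2 s, edge_list F s & y = endpoints s.

(* The graph has vertex set {0, ..., n-1}; the fraction p / q need not be in
   lowest terms. *)
Definition encodes_instance (G : graph 'I_n) (tau : rat) (x : seq nat) : Prop :=
  vertices G = [set: 'I_n] /\
  exists s : seq ('I_n * 'I_n), exists p q : nat,
    [/\ edge_list (edges G) s, 0 < q, tau = (p%:R / q%:R)%R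
      & x = [:: n; #|edges G|; p; q] ++ endpoints s].

End Encodings.

(* Main.v *)
Require Import Defs.
From mathcomp Require Import all_boot all_order all_algebra zify.

Set Implicit Arguments.
Unset Strict Implicit.
Unset Printing Implicit Defensive.

Import Order.TTheory GRing.Theory Num.Theory.

(** A forest has maximum density (k - 1) / k, where k is the size of its largest
    component, so for tau = p / q the task is to cut as few edges as possible so
    that every component, weighing q - p per vertex, weighs at most q. Root the
    tree and treat the vertices by decreasing depth and, at equal depth, by
    increasing weight: merge a vertex v into its parent u if the merged weight
    is at most q, and cut the edge vu otherwise. A cut is forced. A merge is
    safe: an optimal solution that cuts vu can instead cut a sibling of v that
    it keeps, which is at least as heavy as v, or the edge above u. Selecting
    the next vertex by a linear scan gives O(n^2) steps; the parents are found
    by n passes over the edge list.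

    The machine program is the translation of a program in a small language
    whose only loops run n times, so that nesting loops d deep gives O(n^d)
    steps. *)

(** * A loop language and its translation to the machine *)

(* Besides the registers R_i there are arrays A_a; the registers are array 0. *)
Inductive cmd : Type :=
  | CSkip
  | CConst of nat & nat          (* R_i <- c *)
  | CAdd of nat & nat & nat      (* R_i <- R_j + R_k *)
  | CSub of nat & nat & nat      (* R_i <- R_j - R_k *)
  | CLoad of nat & nat & nat     (* with arguments a, i, j: R_i <- A_a[R_j] *)
  | CStore of nat & nat & nat    (* with arguments a, i, j: A_a[R_i] <- R_j *)
  | CRead of nat
  | CPrint of nat
  | CSeq of cmd & cmd
  | CIf of nat & cmd & cmd       (* tests R_i > 0 *)
  | CFor of nat & cmd.           (* for R_i = R_0 - 1 down to 0 *)

Record store : Type :=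
  Store { cell : nat -> nat -> nat; input : seq nat; output : seq nat }.

Notation reg s i := (cell s 0 i).

Definition put (s : store) (a i v : nat) : store :=
  Store (fun b j => if (b == a) && (j == i) then v else cell s b j)
        (input s) (output s).

Definition pop (s : store) : store :=
  Store (cell s) (behead (input s)) (output s).

Definition emit (s : store) (v : nat) : store :=
  Store (cell s) (input s) (rcons (output s) v).

Lemma cell_put s a i v b j :
  cell (put s a i v) b j = if (b == a) && (j == i) then v else cell s b j.
Proof. by []. Qed.

Lemma cell_pop s a i : cell (pop s) a i = cell s a i.
Proof. by []. Qed.

Lemma cell_emit s v a i : cell (emit s v) a i = cell s a i.
Proof. by []. Qed.

Lemma input_put s a i v : input (put s a i v) = input s.
Proof. by []. Qed.

Lemma input_pop s : input (pop s) = behead (input s).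
Proof. by []. Qed.

Lemma output_put s a i v : output (put s a i v) = output s.
Proof. by []. Qed.

Lemma output_pop s : output (pop s) = output s.
Proof. by []. Qed.

Lemma output_emit s v : output (emit s v) = rcons (output s) v.
Proof. by []. Qed.

Definition storeE := (cell_put, cell_pop, cell_emit, input_put, input_pop,
  output_put, output_pop, output_emit).

(* Keeps [/=] from exposing the update functions, so that [storeE] applies. *)
Arguments cell : simpl never.
Arguments input : simpl never.
Arguments output : simpl never.

(* [N] is the constant value of register 0. *)
Fixpoint sem (N : nat) (c : cmd) (s : store) : store :=
  match c with
  | CSkip => s
  | CConst i v => put s 0 i v
  | CAdd i j k => put s 0 i (reg s j + reg s k)
  | CSub i j k => put s 0 i (reg s j - reg s k)
  | CLoad a i j => put s 0 i (cell s a (reg s j))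
  | CStore a i j => put s a (reg s i) (reg s j)
  | CRead i => put (pop s) 0 i (head 0 (input s))
  | CPrint i => emit s (reg s i)
  | CSeq c1 c2 => sem N c2 (sem N c1 s)
  | CIf i c1 c2 => if 0 < reg s i then sem N c1 s else sem N c2 s
  | CFor i c1 =>
      iter N (fun t => sem N c1 (put t 0 i (reg t i - 1))) (put s 0 i N)
  end.

Lemma sem_seq N c1 c2 s : sem N (CSeq c1 c2) s = sem N c2 (sem N c1 s).
Proof. by []. Qed.

Fixpoint may_write (a i : nat) (c : cmd) : bool :=
  match c with
  | CSkip | CPrint _ => false
  | CConst j _ | CAdd j _ _ | CSub j _ _ | CLoad _ j _ | CRead j =>
      (a == 0) && (i == j)
  | CStore b _ _ => a == b
  | CSeq c1 c2 | CIf _ c1 c2 => may_write a i c1 || may_write a i c2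
  | CFor j c1 => (a == 0) && (i == j) || may_write a i c1
  end.

Fixpoint prints (c : cmd) : bool :=
  match c with
  | CPrint _ => true
  | CSeq c1 c2 | CIf _ c1 c2 => prints c1 || prints c2
  | CFor _ c1 => prints c1
  | _ => false
  end.

Lemma iter_invariant (S A : Type) (f : S -> S) (view : S -> A) :
  (forall x, view (f x) = view x) -> forall k x, view (iter k f x) = view x.
Proof. by move=> fv; elim=> //= k IHk x; rewrite fv. Qed.

Lemma sem_frame N a i c s :
  ~~ may_write a i c -> cell (sem N c s) a i = cell s a i.
Proof.
elim: c s => //= [j v|j k l|j k l|b j k|b j k|j|c1 IH1 c2 IH2|
  j c1 IH1 c2 IH2|j c IH] s; rewrite ?negb_or;
  try by move/negPf=> elsewhere; rewrite cell_put elsewhere.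
- by case/andP=> kept1 kept2; rewrite IH2 // IH1.
- by case/andP=> kept1 kept2; case: ifP => _; [exact: IH1 | exact: IH2].
case/andP=> /negPf elsewhere kept.
rewrite (iter_invariant (view := fun t => cell t a i)) => [|t].
  by rewrite cell_put elsewhere.
by rewrite IH // cell_put elsewhere.
Qed.

Lemma sem_silent N c s : ~~ prints c -> output (sem N c s) = output s.
Proof.
elim: c s => //= [c1 IH1 c2 IH2|j c1 IH1 c2 IH2|j c IH] s; rewrite ?negb_or.
- by case/andP=> silent1 silent2; rewrite IH2 // IH1.
- by case/andP=> silent1 silent2; case: ifP => _; [exact: IH1 | exact: IH2].
by move=> silent; rewrite (iter_invariant (view := output)) // => t; rewrite IH.
Qed.

(* The counter takes the values [N - 1, ..., 0]: [I r] is the invariant when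
   [r] iterations remain. *)
Lemma sem_for_ind N i c (I : nat -> store -> Prop) s : ~~ may_write 0 i c ->
  I N (put s 0 i N) ->
  (forall r t, r < N -> reg t i = r -> I r.+1 t -> I r (sem N c t)) ->
  (forall r t v, I r t -> I r (put t 0 i v)) ->
  I 0 (sem N (CFor i c) s).
Proof.
move=> kept I_init I_step I_put /=.
set f := fun t => sem N c _.
suff inv k : k <= N -> reg (iter k f (put s 0 i N)) i = N - k /\
    I (N - k) (iter k f (put s 0 i N)).
  by have [_] := inv N (leqnn N); rewrite subnn.
elim: k => [|k IHk] lt_kN; first by rewrite subn0 cell_put !eqxx.
rewrite iterS; move: (iter k f _) (IHk (ltnW lt_kN)) => t [counter It].
have decremented : reg (put t 0 i (reg t i - 1)) i = N - k.+1.
  by rewrite cell_put !eqxx /= counter; lia.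
rewrite /f; split; first by rewrite sem_frame.
apply: I_step => //; first lia.
by apply: I_put; have -> : (N - k.+1).+1 = N - k by lia.
Qed.

Fixpoint code_size (c : cmd) : nat :=
  match c with
  | CSkip => 0
  | CConst _ _ | CAdd _ _ _ | CSub _ _ _ | CRead _ | CPrint _ => 1
  | CLoad _ _ _ | CStore _ _ _ => 6
  | CSeq c1 c2 => code_size c1 + code_size c2
  | CIf _ c1 c2 => code_size c1 + code_size c2 + 3
  | CFor _ c1 => code_size c1 + 5
  end.

Fixpoint time_bound (N : nat) (c : cmd) : nat :=
  match c with
  | CSkip => 0
  | CConst _ _ | CAdd _ _ _ | CSub _ _ _ | CRead _ | CPrint _ => 1
  | CLoad _ _ _ | CStore _ _ _ => 6
  | CSeq c1 c2 => time_bound N c1 + time_bound N c2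
  | CIf _ c1 c2 => time_bound N c1 + time_bound N c2 + 3
  | CFor _ c1 => 2 + N * (time_bound N c1 + 3)
  end.

Fixpoint loop_depth (c : cmd) : nat :=
  match c with
  | CSeq c1 c2 | CIf _ c1 c2 => maxn (loop_depth c1) (loop_depth c2)
  | CFor _ c1 => (loop_depth c1).+1
  | _ => 0
  end.

Lemma time_bound_loop_depth N c :
  0 < N -> time_bound N c <= time_bound 1 c * N ^ loop_depth c.
Proof.
move=> N_gt0.
have pow_mono a b k : a <= b -> k * N ^ a <= k * N ^ b.
  by move=> le_ab; rewrite leq_mul2l leq_pexp2l ?orbT.
have le_pow k d : k <= k * N ^ d by rewrite leq_pmulr // expn_gt0 N_gt0.
elim: c => //= [c1 IH1 c2 IH2|_ c1 IH1 c2 IH2|_ c IH].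
- rewrite mulnDl leq_add //.
    exact: leq_trans IH1 (pow_mono _ _ _ (leq_maxl _ _)).
  exact: leq_trans IH2 (pow_mono _ _ _ (leq_maxr _ _)).
- rewrite !mulnDl !leq_add ?le_pow //.
    exact: leq_trans IH1 (pow_mono _ _ _ (leq_maxl _ _)).
  exact: leq_trans IH2 (pow_mono _ _ _ (leq_maxr _ _)).
rewrite mul1n mulnDl leq_add ?le_pow //.
by rewrite expnS mulnCA leq_mul2l mulnDl leq_add ?le_pow ?IH ?orbT.
Qed.

Lemma bigO_time_bound c d :
  loop_depth c <= d -> bigO (fun n => (time_bound n c).+1) (fun n => n ^ d).
Proof.
move=> le_d; exists (time_bound 1 c).+1, 1 => n n_gt0.
rewrite mulSn -add1n leq_add ?expn_gt0 ?n_gt0 //.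
apply: leq_trans (time_bound_loop_depth c n_gt0) _.
by rewrite leq_mul2l leq_pexp2l ?orbT.
Qed.

Definition num_arrays := 7.

Fixpoint wf_cmd (c : cmd) : bool :=
  match c with
  | CLoad a _ _ | CStore a _ _ => a < num_arrays
  | CSeq c1 c2 | CIf _ c1 c2 => wf_cmd c1 && wf_cmd c2
  | CFor i c1 => ~~ may_write 0 i c1 && wf_cmd c1
  | _ => true
  end.

(* The arrays are interleaved; the unused array 7 provides scratch cells. *)
Definition addr (a i : nat) : nat := 8 * i + a.

Definition scratch (k : nat) : nat := addr 7 k.

Definition address_code (a i : nat) : program :=
  [:: IAdd (scratch 0) (addr 0 i) (addr 0 i);
      IAdd (scratch 0) (scratch 0) (scratch 0);
      IAdd (scratch 0) (scratch 0) (scratch 0);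
      IConst (scratch 1) a; IAdd (scratch 0) (scratch 0) (scratch 1)].

Definition goto_code (l : nat) : program :=
  [:: IConst (scratch 0) 1; IJpos (scratch 0) l].

Definition copy_code (i j : nat) : program :=
  [:: IConst (scratch 0) 0; IAdd (addr 0 i) (addr 0 j) (scratch 0)].

Definition decrement_code (i : nat) : program :=
  [:: IConst (scratch 0) 1; ISub (addr 0 i) (addr 0 i) (scratch 0)].

(* The code is placed from address [o] on. *)
Fixpoint compile (o : nat) (c : cmd) : program :=
  match c with
  | CSkip => [::]
  | CConst i v => [:: IConst (addr 0 i) v]
  | CAdd i j k => [:: IAdd (addr 0 i) (addr 0 j) (addr 0 k)]
  | CSub i j k => [:: ISub (addr 0 i) (addr 0 j) (addr 0 k)]
  | CLoad a i j => address_code a j ++ [:: ILoad (addr 0 i) (scratch 0)]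
  | CStore a i j => address_code a i ++ [:: IStore (scratch 0) (addr 0 j)]
  | CRead i => [:: IRead (addr 0 i)]
  | CPrint i => [:: IPrint (addr 0 i)]
  | CSeq c1 c2 => compile o c1 ++ compile (o + code_size c1) c2
  | CIf i c1 c2 =>
      IJpos (addr 0 i) (o + 1 + code_size c2 + 2) :: compile (o + 1) c2 ++
      goto_code (o + 1 + code_size c2 + 2 + code_size c1) ++
      compile (o + 1 + code_size c2 + 2) c1
  | CFor i c1 =>
      copy_code i 0 ++ decrement_code i ++ compile (o + 2 + 2) c1 ++
      [:: IJpos (addr 0 i) (o + 2)]
  end.

Lemma size_compile o c : size (compile o c) = code_size c.
Proof.
elim: c o => //= [c1 IH1 c2 IH2|i c1 IH1 c2 IH2|i c1 IH1] o;
  rewrite !size_cat /= ?size_cat ?IH1 ?IH2 /=; lia.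
Qed.

Definition code_at (P : program) (o : nat) (l : program) : Prop :=
  forall k, k < size l -> onth P (o + k) = onth l k.

Lemma code_at_cat P o l1 l2 :
  code_at P o (l1 ++ l2) -> code_at P o l1 /\ code_at P (o + size l1) l2.
Proof.
move=> at12; split=> k lt_k.
  by rewrite at12 ?size_cat ?onth_cat ?lt_k //; lia.
rewrite -addnA at12 ?size_cat ?onth_cat ?ltn_add2l //.
by rewrite ltnNge leq_addr /= addKn.
Qed.

Lemma code_at_cons P o c l :
  code_at P o (c :: l) -> onth P o = Some c /\ code_at P (o + 1) l.
Proof.
rewrite -cat1s => /code_at_cat[at_c at_l]; split=> //.
by rewrite -[o]addn0 at_c.
Qed.

Definition jump_free (c : instr) : bool :=
  if c is IJpos _ _ then false else true.

Definition exec_seq (l : program) (s : state) : state :=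
  foldl (fun t c => exec c t) s l.

Lemma exec_seq_cat l1 l2 s :
  exec_seq (l1 ++ l2) s = exec_seq l2 (exec_seq l1 s).
Proof. exact: foldl_cat. Qed.

Lemma step_fetch P c o m r w :
  onth P o = Some c -> step P (State o m r w) = exec c (State o m r w).
Proof. by rewrite /step /= => ->. Qed.

Lemma pc_exec c s : jump_free c -> pc (exec c s) = (pc s).+1.
Proof. by case: c s => [??|???|???|??|??|??|?|?] []. Qed.

Lemma iter_step_jump_free P l s : code_at P (pc s) l -> all jump_free l ->
  iter (size l) (step P) s = exec_seq l s.
Proof.
elim: l s => // c l IHl [o m r w] /code_at_cons[at_c at_l] /andP[jf_c jf_l].
by rewrite iterSr (step_fetch _ _ _ at_c) IHl // pc_exec // -addn1.
Qed.

Definition represents (m : nat -> nat) (s : store) : Prop :=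
  forall a i, a < num_arrays -> m (addr a i) = cell s a i.

Lemma upd_eq m i v : upd m i v i = v.
Proof. by rewrite /upd eqxx. Qed.

Lemma represents_put m s a i v : a < num_arrays -> represents m s ->
  represents (upd m (addr a i) v) (put s a i v).
Proof.
rewrite /represents /num_arrays => lt_a rep b j lt_b; rewrite cell_put /upd.
have -> : (addr b j == addr a i) = (b == a) && (j == i) by rewrite /addr; lia.
by case: ifP => // _; exact: rep.
Qed.

Lemma represents_scratch m s k v :
  represents m s -> represents (upd m (scratch k) v) s.
Proof.
rewrite /represents /num_arrays => rep a i lt_a; rewrite /upd.
have -> : (addr a i == scratch k) = false by rewrite /scratch /addr; lia.
exact: rep.
Qed.

Definition embed (o : nat) (m : nat -> nat) (s : store) : state :=
  State o m (input s) (output s).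

Definition runs_within (P : program) (T o o' : nat) (s s' : store) : Prop :=
  forall m, represents m s -> exists t m',
    [/\ t <= T, represents m' s'
      & iter t (step P) (embed o m s) = embed o' m' s'].

Lemma runs_within_refl P T o s : runs_within P T o o s s.
Proof. by move=> m rep; exists 0, m. Qed.

Lemma runs_within_leq P T T' o o' s s' :
  T <= T' -> runs_within P T o o' s s' -> runs_within P T' o o' s s'.
Proof.
move=> le_T run m /run[t [m' [le_t rep e]]].
by exists t, m'; split=> //; exact: leq_trans le_T.
Qed.

Lemma runs_within_trans P T1 T2 o1 o2 o3 s1 s2 s3 :
  runs_within P T1 o1 o2 s1 s2 -> runs_within P T2 o2 o3 s2 s3 ->
  runs_within P (T1 + T2) o1 o3 s1 s3.
Proof.
move=> run12 run23 m /run12[t1 [m1 [le_t1 rep1 iter1]]].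
have [t2 [m2 [le_t2 rep2 iter2]]] := run23 _ rep1.
exists (t2 + t1), m2; rewrite iterD iter1 iter2 addnC.
by split=> //; exact: leq_add.
Qed.

Lemma runs_within_jump_free P l o s s' : code_at P o l -> all jump_free l ->
  (forall m, represents m s -> exists2 m', represents m' s' &
     exec_seq l (embed o m s) = embed (o + size l) m' s') ->
  runs_within P (size l) o (o + size l) s s'.
Proof.
move=> at_l jf exec_l m /exec_l[m' rep e]; exists (size l), m'; split=> //.
by rewrite iter_step_jump_free.
Qed.

Lemma runs_within_instr P o c s s' : code_at P o [:: c] -> jump_free c ->
  (forall m, represents m s -> exists2 m', represents m' s' &
     exec c (embed o m s) = embed o.+1 m' s') ->
  runs_within P 1 o (o + 1) s s'.
Proof.
move=> at_o jf_c exec_c; apply: (runs_within_jump_free at_o) => [|m /exec_c] /=.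
  by rewrite jf_c.
by rewrite addn1.
Qed.

Lemma runs_within_jump P o i l s : onth P o = Some (IJpos (addr 0 i) l) ->
  runs_within P 1 o (if 0 < reg s i then l else o + 1) s s.
Proof.
move=> at_o m rep; exists 1, m; split=> //.
by rewrite /iter (step_fetch _ _ _ at_o) /= rep // addn1.
Qed.

Lemma runs_within_goto P o l s :
  code_at P o (goto_code l) -> runs_within P 2 o l s s.
Proof.
case/code_at_cons=> at_const /code_at_cons[at_jump _] m rep.
exists 2, (upd m (scratch 0) 1); split=> //; first exact: represents_scratch.
rewrite /iter (step_fetch _ _ _ at_const) /= -addn1.
by rewrite (step_fetch _ _ _ at_jump).
Qed.

Lemma runs_within_copy P o i j s : code_at P o (copy_code i j) ->
  runs_within P 2 o (o + 2) s (put s 0 i (reg s j)).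
Proof.
move=> at_o; apply: (runs_within_jump_free at_o) => // m rep.
eexists; last by rewrite /= addn2.
have rep' : represents (upd m (scratch 0) 0) s by exact: represents_scratch.
by rewrite rep' // upd_eq addn0; exact: represents_put.
Qed.

Lemma runs_within_decrement P o i s : code_at P o (decrement_code i) ->
  runs_within P 2 o (o + 2) s (put s 0 i (reg s i - 1)).
Proof.
move=> at_o; apply: (runs_within_jump_free at_o) => // m rep.
eexists; last by rewrite /= addn2.
have rep' : represents (upd m (scratch 0) 1) s by exact: represents_scratch.
by rewrite rep' // upd_eq; exact: represents_put.
Qed.

Lemma exec_address_code a i o m s : represents m s ->
  exists m', [/\ represents m' s, m' (scratch 0) = addr a (reg s i)
    & exec_seq (address_code a i) (embed o m s) = embed (o + 5) m' s].
Proof.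
move=> rep; eexists; split; last by rewrite [o + 5]addnC.
  by do !apply: represents_scratch.
by rewrite !rep // /upd /= /addr; lia.
Qed.

Lemma runs_within_load P o a i j s : a < num_arrays ->
  code_at P o (address_code a j ++ [:: ILoad (addr 0 i) (scratch 0)]) ->
  runs_within P 6 o (o + 6) s (put s 0 i (cell s a (reg s j))).
Proof.
move=> lt_a at_o; apply: (runs_within_jump_free at_o) => // m rep.
rewrite exec_seq_cat.
have [m' [rep' target ->]] := exec_address_code a j o rep.
eexists; last by rewrite /= -addn1 -addnA.
by rewrite target rep' //; exact: represents_put.
Qed.

Lemma runs_within_store P o a i j s : a < num_arrays ->
  code_at P o (address_code a i ++ [:: IStore (scratch 0) (addr 0 j)]) ->
  runs_within P 6 o (o + 6) s (put s a (reg s i) (reg s j)).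
Proof.
move=> lt_a at_o; apply: (runs_within_jump_free at_o) => // m rep.
rewrite exec_seq_cat.
have [m' [rep' target ->]] := exec_address_code a i o rep.
eexists; last by rewrite /= -addn1 -addnA.
by rewrite target rep' //; exact: represents_put.
Qed.

Definition compiled_correctly (N : nat) (P : program) (c : cmd) : Prop :=
  forall o s, reg s 0 = N -> code_at P o (compile o c) ->
    runs_within P (time_bound N c) o (o + code_size c) s (sem N c s).

Section CompilerCorrectness.
Variables (N : nat) (P : program).

Lemma compile_seq_correct c1 c2 : ~~ may_write 0 0 c1 ->
  compiled_correctly N P c1 -> compiled_correctly N P c2 ->
  compiled_correctly N P (CSeq c1 c2).
Proof.
move=> kept correct1 correct2 o s reg0 /code_at_cat[at_c1].
rewrite size_compile => at_c2.
apply: runs_within_trans (correct1 _ _ reg0 at_c1) _.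
by rewrite addnA; apply: correct2 => //; rewrite sem_frame.
Qed.

Lemma compile_if_correct i c1 c2 :
  compiled_correctly N P c1 -> compiled_correctly N P c2 ->
  compiled_correctly N P (CIf i c1 c2).
Proof.
move=> correct1 correct2 o s reg0; cbn [compile] => /code_at_cons[at_jump].
case/code_at_cat=> at_c2; rewrite size_compile => /code_at_cat[at_goto at_c1].
have := runs_within_jump (s := s) at_jump; rewrite /=.
have -> : o + (code_size c1 + code_size c2 + 3) =
  o + 1 + code_size c2 + 2 + code_size c1 by lia.
case: ifP => _ jump.
  apply: (@runs_within_leq _ (1 + time_bound N c1)); first lia.
  by apply: runs_within_trans jump _; exact: correct1.
apply: (@runs_within_leq _ (1 + (time_bound N c2 + 2))); first lia.
apply: runs_within_trans jump (runs_within_trans (correct2 _ _ reg0 at_c2) _).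
exact: runs_within_goto.
Qed.

Lemma compile_for_correct i c : 0 < N -> ~~ may_write 0 0 (CFor i c) ->
  ~~ may_write 0 i c -> compiled_correctly N P c ->
  compiled_correctly N P (CFor i c).
Proof.
move=> N_gt0 /= /norP[neq_0i kept0] kept_i correct o s reg0; cbn [compile].
case/code_at_cat=> at_copy /code_at_cat[at_decr /code_at_cat[at_c]].
rewrite size_compile => /code_at_cons[at_jump _].
have put0 t v : reg (put t 0 i v) 0 = reg t 0.
  by rewrite cell_put (negPf neq_0i).
cbn [time_bound sem code_size].
set body := fun t => sem N c _.
have iterations k t : 0 < k -> reg t i = k -> reg t 0 = N ->
    runs_within P (k * (time_bound N c + 3)) (o + 2)
      (o + 2 + 2 + code_size c + 1)
      t (iter k body t).
  elim: k t => // k IHk t _ counter t0; rewrite iterSr mulSn.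
  have t'0 : reg (body t) 0 = N by rewrite sem_frame // put0.
  have t'i : reg (body t) i = k.
    by rewrite sem_frame // cell_put !eqxx counter subn1.
  have run_body : runs_within P (2 + time_bound N c + 1) (o + 2)
      (if 0 < k then o + 2 else o + 2 + 2 + code_size c + 1) t (body t).
    have run_decr := runs_within_decrement (s := t) at_decr.
    apply: runs_within_trans (runs_within_trans run_decr _) _.
      by apply: correct at_c; rewrite put0.
    by rewrite -t'i; exact: runs_within_jump.
  case: k => [|k] in IHk t'i counter run_body *.
    by apply: runs_within_leq run_body; lia.
  apply: runs_within_leq (runs_within_trans run_body (IHk _ isT t'i t'0)).
  lia.
have -> : o + (code_size c + 5) = o + 2 + 2 + code_size c + 1 by lia.
apply: runs_within_trans (runs_within_copy at_copy) _; rewrite reg0.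
by apply: iterations; rewrite ?put0 // cell_put !eqxx.
Qed.

Lemma compile_correct c : 0 < N -> wf_cmd c -> ~~ may_write 0 0 c ->
  compiled_correctly N P c.
Proof.
move=> N_gt0.
elim: c => [|i v|i j k|i j k|a i j|a i j|i|i|c1 IH1 c2 IH2|i c1 IH1 c2 IH2|
  i c IH].
- by move=> _ _ o s _ _; rewrite addn0; exact: runs_within_refl.
- move=> _ _ o s _ at_o; apply: (runs_within_instr at_o) => // m rep.
  by eexists; last reflexivity; exact: represents_put.
- move=> _ _ o s _ at_o; apply: (runs_within_instr at_o) => // m rep.
  by eexists; last reflexivity; rewrite !rep //; exact: represents_put.
- move=> _ _ o s _ at_o; apply: (runs_within_instr at_o) => // m rep.
  by eexists; last reflexivity; rewrite !rep //; exact: represents_put.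
- by move=> lt_a _ o s _; exact: runs_within_load.
- by move=> lt_a _ o s _; exact: runs_within_store.
- move=> _ _ o s _ at_o; apply: (runs_within_instr at_o) => // m rep.
  by eexists; last reflexivity; exact: represents_put.
- move=> _ _ o s _ at_o; apply: (runs_within_instr at_o) => // m rep.
  by exists m => //=; rewrite rep.
- move=> /andP[wf1 wf2] /norP[kept1 kept2].
  by apply: compile_seq_correct => //; [exact: IH1 | exact: IH2].
- move=> /andP[wf1 wf2] /norP[kept1 kept2].
  by apply: compile_if_correct; [exact: IH1 | exact: IH2].
move=> /andP[kept_i wf] kept0; apply: compile_for_correct => //.
by apply: IH => //; case/norP: kept0.
Qed.

End CompilerCorrectness.

Definition loaded (n : nat) (x : seq nat) : store :=
  put (Store (fun _ _ => 0) x [::]) 0 0 n.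

Definition stand_alone (c : cmd) : program := IRead (addr 0 0) :: compile 1 c.

Lemma stand_alone_outputs_within c n x t :
  0 < n -> wf_cmd c -> ~~ may_write 0 0 c ->
  time_bound n c < t ->
  outputs_within (stand_alone c) (n :: x) t (output (sem n c (loaded n x))).
Proof.
move=> n_gt0 wf kept lt_t; set P := stand_alone c.
have at_c : code_at P 1 (compile 1 c) by move=> k _; rewrite add1n.
have rep : represents (upd (fun=> 0) (addr 0 0) n) (loaded n x).
  exact: represents_put.
have reg0 : reg (loaded n x) 0 = n by [].
have [t' [m' [le_t' _ run]]] := compile_correct n_gt0 wf kept reg0 at_c rep.
set final := embed _ m' _ in run.
have is_halted : halted P final by rewrite /halted /= size_compile.
have -> : t = t - t'.+1 + (t' + 1) by lia.
rewrite /outputs_within iterD iterD [iter 1 _ _]/(embed 1 _ (loaded n x)) run.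
by rewrite iter_fix // /step onth_default.
Qed.

(** * Density *)

Section Edges.
Variables (T : finType) (H : graph T).

Lemma edge_sub e : e \in edges H -> e \subset vertices H.
Proof. by move/forall_inP: (graphP H) => /[apply] /andP[]. Qed.

Lemma card_edge e : e \in edges H -> #|e| = 2.
Proof. by move/forall_inP: (graphP H) => /[apply] /andP[_ /eqP]. Qed.

Lemma density_leE p q : 0 < q ->
  (density H <= p%:R / q%:R)%R = (q * #|edges H| <= p * #|vertices H|).
Proof.
move=> q_gt0; rewrite /density; have [V0|V_gt0] := posnP #|vertices H|.
  have -> : #|edges H| = 0.
    apply/eq_card0 => e; apply/negP => eH.
    by have := subset_leq_card (edge_sub eH); rewrite V0 card_edge.
  by rewrite V0 muln0 mul0r divr_ge0 ?ler0n.
rewrite ler_pdivrMr ?ltr0n // mulrAC ler_pdivlMr ?ltr0n //.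
by rewrite -!natrM ler_nat mulnC.
Qed.

End Edges.

Lemma max_density_leP (T : finType) (G : graph T) p q : 0 < q ->
  reflect (forall H, subgraph H G -> q * #|edges H| <= p * #|vertices H|)
          (max_density G <= p%:R / q%:R)%R.
Proof.
move=> q_gt0; apply: (iffP idP) => [le_tau H sub|sparse].
  rewrite -density_leE //; apply: le_trans le_tau.
  exact: (bigmax_sup H).
apply: bigmax_le => [|H sub]; first by rewrite divr_ge0 ?ler0n.
by rewrite density_leE // sparse.
Qed.

(** * Cutting a rooted tree *)

Lemma subset_setC1 (T : finType) (A : {set T}) x :
  (A \subset [set~ x]) = (x \notin A).
Proof. by rewrite subsetC sub1set inE. Qed.

Lemma leq_sum_sub (I : finType) (P P' : pred I) (F : I -> nat) :
  (forall i, P i -> P' i) -> \sum_(i | P i) F i <= \sum_(i | P' i) F i.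
Proof. by apply: (@sub_le_big _ _ leq) => // m n; exact: leq_addr. Qed.

Lemma card_disjoint_bigcup (I T : finType) (P : pred I) (B : I -> {set T}) :
  {in P &, forall i j, i != j -> [disjoint B i & B j]} ->
  #|\bigcup_(i | P i) B i| = \sum_(i | P i) #|B i|.
Proof.
move=> disj; rewrite big_mkcond -sum1_card.
rewrite partition_disjoint_bigcup => [|i j neq_ij].
  rewrite [RHS]big_mkcond; apply: eq_bigr => i _.
  by case: ifP => _; rewrite sum1_card // cards0.
by case: ifP => Pi; case: ifP => Pj; rewrite -setI_eq0 ?set0I ?setI0 //
  setI_eq0 disj.
Qed.

Lemma leq_card_bigcup (I T : finType) (P : pred I) (B : I -> {set T}) :
  #|\bigcup_(i | P i) B i| <= \sum_(i | P i) #|B i|.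
Proof.
elim/big_rec2: _ => [|i k A _ le_k]; first by rewrite cards0.
exact: leq_trans (leq_card_setU _ _).1 (leq_add (leqnn _) le_k).
Qed.

Section RootedTree.
Variables (T : finType) (root : T) (par : T -> T) (dep : T -> nat).
Hypothesis dep_par : forall v, v != root -> dep v = (dep (par v)).+1.

Lemma par_neq v : v != root -> par v != v.
Proof. by move=> /dep_par dv; apply: contra_eqN dv => /eqP->; lia. Qed.

Lemma leaves_up_ind (P : T -> Prop) :
  (forall x, (forall y, y != root -> par y = x -> P y) -> P x) ->
  forall x, P x.
Proof.
move=> IH x; have [k] := ubnP (\max_y dep y - dep x).
elim: k x => // k IHk x lt_k; apply: IH => y /dep_par dy par_y; apply: IHk.
by have := @leq_bigmax T dep y; rewrite dy par_y in lt_k *; lia.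
Qed.

Lemma root_down_ind (P : T -> Prop) :
  (forall x, (x != root -> P (par x)) -> P x) -> forall x, P x.
Proof.
move=> IH x; have [k] := ubnP (dep x).
elim: k x => // k IHk x lt_k; apply: IH => /dep_par dx; apply: IHk.
by rewrite -ltnS -dx.
Qed.

Section Branches.
Variable F : {set T}.

(* A set [F] of vertices stands for the cut edges from its members to their
   parents; whether it contains the root does not matter. *)
Definition uncut : rel T :=
  [rel y x | [&& y != root, par y == x & y \notin F]].

Definition branch (x : T) : {set T} := [set y | connect uncut y x].

Lemma uncut_dep y x : uncut y x -> dep y = (dep x).+1.
Proof. by case/and3P=> /dep_par dy /eqP<-. Qed.

Lemma branch_refl x : x \in branch x.
Proof. by rewrite inE connect0. Qed.

Lemma branch_up x z :
  z \in branch x -> z != x -> uncut z (par z) /\ par z \in branch x.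
Proof.
rewrite inE => /connectP[[|y p] /= up ->]; first by rewrite eqxx.
case/andP: up => /[dup] zy /and3P[_ /eqP-> _] up _; split=> //.
by rewrite inE; apply/connectP; exists p.
Qed.

Lemma branch_down x y z : uncut z y -> y \in branch x -> z \in branch x.
Proof. by rewrite !inE => /connect1; exact: connect_trans. Qed.

Lemma branch_sub y x : uncut y x -> branch y \subset branch x.
Proof.
move=> yx; apply/subsetP => z; rewrite !inE => zy.
exact: connect_trans zy (connect1 yx).
Qed.

Lemma branch_ind x (P : T -> Prop) :
  P x -> (forall z y, uncut z y -> y \in branch x -> P y -> P z) ->
  forall z, z \in branch x -> P z.
Proof.
move=> Px Pdown z; rewrite inE => /connectP[p].
elim: p z => [|y p IHp] z /= => [_ <- //|/andP[zy up_y] last_p].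
apply: Pdown zy _ (IHp y up_y last_p).
by rewrite inE; apply/connectP; exists p.
Qed.

Lemma branch_dep x z : z \in branch x -> dep x <= dep z.
Proof.
by move: z; apply: branch_ind => // z y /uncut_dep-> _; exact: leqW.
Qed.

Lemma branch_dep_inj x y : x \in branch y -> dep x = dep y -> x = y.
Proof.
move=> xy dep_xy; apply/eqP/negPn/negP => /(branch_up xy)[/uncut_dep dx].
by move/branch_dep; rewrite -dep_xy dx ltnn.
Qed.

Lemma branch_top_inj x y z :
  z \in branch x -> z \in branch y -> dep x = dep y -> x = y.
Proof.
move=> + + dep_xy; move: z; apply: branch_ind => [xy|z w zw wx IHw zy].
  exact: branch_dep_inj.
have [zy_eq|/(branch_up zy)[_ pzy]] := eqVneq z y; last first.
  by apply: IHw; case/and3P: zw => _ /eqP<- _.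
by apply/esym/branch_dep_inj; rewrite // -zy_eq; exact: branch_down zw wx.
Qed.

Lemma branchE x : branch x = x |: \bigcup_(y | uncut y x) branch y.
Proof.
apply/setP => z; rewrite in_setU1; apply/idP/orP; last first.
  by case=> [/eqP->|/bigcupP[y yx]];
    [exact: branch_refl | exact/subsetP/branch_sub].
move: z; apply: branch_ind => [|z y zy _ [/eqP yx|/bigcupP[t tx yt]]].
- by left.
- right.
  by apply/bigcupP; exists z; rewrite ?branch_refl // -yx.
right; by apply/bigcupP; exists t => //; exact: branch_down zy yt.
Qed.

Lemma card_branch x : #|branch x| = 1 + \sum_(y | uncut y x) #|branch y|.
Proof.
rewrite {1}branchE cardsU1 card_disjoint_bigcup => [|y y' yx y'x neq_yy'].
  congr (_ + _); case: bigcupP => // -[y /uncut_dep dy /branch_dep].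
  by rewrite dy ltnn.
apply/pred0P => z /=; apply: contra_neqF neq_yy' => /andP[zy zy'].
by apply: branch_top_inj zy zy' _; rewrite (uncut_dep yx) (uncut_dep y'x).
Qed.

End Branches.

Section Loads.
Variables (mass q : nat).

Definition load (F : {set T}) (x : T) : nat := mass * #|branch F x|.

Definition feasible (F : {set T}) : bool := [forall x, load F x <= q].

Lemma loadE (F : {set T}) x : load F x = mass + \sum_(y | uncut F y x) load F y.
Proof. by rewrite /load card_branch mulnDr muln1 big_distrr. Qed.

Lemma eq_load (F F' : {set T}) x :
  (forall y, y != root -> (y \in F) = (y \in F')) ->
  load F x = load F' x.
Proof.
move=> eqF; rewrite /load; congr (_ * _); apply: eq_card => z; rewrite !inE.
by apply: eq_connect => y y'; rewrite /uncut /=; case: eqP => //= /eqP/eqF->.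
Qed.

Lemma load_supersolution (F : {set T}) (g : T -> nat) :
  (forall y, mass + \sum_(z | uncut F z y) g z <= g y) ->
  forall y, load F y <= g y.
Proof.
move=> super; elim/leaves_up_ind=> y IH; apply: leq_trans (super y).
rewrite loadE leq_add2l; apply: leq_sum => z /and3P[zr /eqP par_z _].
exact: IH.
Qed.

Lemma feasible_setT : mass <= q -> feasible setT.
Proof.
move=> le_mass; apply/forallP=> x; rewrite loadE big_pred0 ?addn0 // => y.
by rewrite /uncut /= inE !andbF.
Qed.

Lemma uncut_exchange (F : {set T}) v x z y : v \in F ->
  uncut (x |: F :\ v) z y && (z != v) = uncut F z y && (z != x).
Proof.
move=> vF; rewrite /uncut /= !inE negb_or negb_and negbK.
have [->|_] := eqVneq z v; first by rewrite vF !andbF.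
by rewrite andbT /= -!andbA; do !bool_congr; rewrite andbC.
Qed.

Lemma exchange_sibling (F : {set T}) v x :
  v \in F -> x \notin F -> v != root -> x != root -> par x = par v ->
  load F v <= load F x -> feasible F -> feasible (x |: F :\ v).
Proof.
move=> vF xF vr xr par_x le_vx /forallP feasF; apply/forallP=> y.
apply: leq_trans (feasF y); apply: load_supersolution => {}y.
rewrite [leqRHS]loadE leq_add2l.
have vx : v != x by apply: contraNneq xF => <-.
have [->|y_par] := eqVneq y (par v).
  rewrite (bigD1 v) /=; last first.
    by rewrite /uncut /= vr eqxx !inE !eqxx /= (negPf vx).
  rewrite [leqRHS](bigD1 x) /=; last by rewrite /uncut /= xr par_x eqxx.
  by rewrite leq_add // (eq_bigl _ _ (fun z => uncut_exchange x z (par v) vF)).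
apply: leq_sum_sub => z zy.
have := uncut_exchange x z y vF; rewrite zy andTb.
case: eqP => [zv|_ /esym/andP[]//].
by case/and3P: zy y_par => _ /eqP<-; rewrite zv eqxx.
Qed.

Lemma exchange_parent (F : {set T}) v : v \in F -> v != root ->
  load F (par v) + load F v <= q -> feasible F -> feasible (par v |: F :\ v).
Proof.
move=> vF vr; set u := par v => fits /forallP feasF.
have uv : u != v := par_neq vr.
pose g := [eta load F with u |-> load F u + load F v].
have g_u : g u = load F u + load F v by rewrite /g /= eqxx.
have g_other y : y != u -> g y = load F y by rewrite /g /= => /negPf->.
clearbody g.
apply/forallP => y; apply: (@leq_trans (g y)); last first.
  by have [->|/g_other->] := eqVneq y u; rewrite ?g_u.
apply: load_supersolution => {}y.
have others : \sum_(z | uncut (u |: F :\ v) z y && (z != v)) g z <=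
    \sum_(z | uncut F z y) load F z.
  rewrite (eq_bigl _ _ (fun z => uncut_exchange u z y vF)).
  rewrite (eq_bigr (load F)) => [|z /andP[_ /g_other//]].
  by apply: leq_sum_sub => z /andP[].
have [y_u|yu] := eqVneq y u.
  rewrite (bigD1 v) /=; last first.
    by rewrite /uncut /= vr y_u eqxx !inE eqxx [v == u]eq_sym (negPf uv).
  rewrite y_u in others *; rewrite g_u g_other 1?eq_sym // [load F u]loadE.
  by rewrite -addnA leq_add2l addnC leq_add2r.
rewrite g_other // loadE leq_add2l; apply: leq_trans others.
apply: leq_sum_sub => z zy; rewrite zy; apply: contraNneq yu => zv.
by case/and3P: zy => _ /eqP<- _; rewrite zv.
Qed.

(* [D] is the set of treated vertices, [C] the set of the cut ones among them,
   and [w x] the weight of the component of [x] built so far. *)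
Record greedy_state (D C : {set T}) (w : T -> nat) : Prop := GreedyState {
  root_untreated : root \notin D;
  cuts_treated : C \subset D;
  deeper_treated : forall x y, x \in D -> dep x < dep y -> y \in D;
  weight_children : forall x,
    w x = mass + \sum_(y | (par y == x) && (y \in D :\: C)) w y;
  cuts_extend : exists F, [/\ feasible F, F :&: D = C &
    forall F', feasible F' -> #|F| <= #|F'|] }.

Record selected (D : {set T}) (w : T -> nat) (v : T) : Prop := Selected {
  selected_untreated : v \notin D;
  selected_neq_root : v != root;
  selected_deepest : forall y, y \notin D -> dep y <= dep v;
  selected_lightest : forall y, y \notin D -> dep y = dep v -> w v <= w y }.

Lemma eq_greedy_state D C w w' :
  w =1 w' -> greedy_state D C w -> greedy_state D C w'.
Proof.
move=> eq_w [rD sCD deeper wE ext]; split=> // x; rewrite -eq_w wE.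
by congr (_ + _); apply: eq_bigr => y _; rewrite eq_w.
Qed.

Lemma greedy_init : mass <= q -> greedy_state set0 set0 (fun=> mass).
Proof.
move=> le_mass; split; rewrite ?inE ?sub0set //.
- by move=> x y; rewrite inE.
- by move=> x; rewrite big1 ?addn0 // => y; rewrite !inE !andbF.
have [F feasF minF] :=
  arg_minnP (fun F : {set T} => #|F|) (feasible_setT le_mass).
by exists F; rewrite setI0.
Qed.

Lemma greedy_done D C w :
  greedy_state D C w -> (forall v, v != root -> v \in D) ->
  feasible C /\ forall F, feasible F -> #|C| <= #|F|.
Proof.
case=> _ _ _ _ [F [/forallP feasF FD minF]] all_treated.
have agree v : v != root -> (v \in C) = (v \in F).
  by move=> /all_treated vD; rewrite -FD inE vD andbT.
split=> [|F' /minF]; first by apply/forallP => x; rewrite (eq_load _ agree).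
by apply: leq_trans; rewrite -FD subset_leq_card // subsetIl.
Qed.

Section Selection.
Variables (D C : {set T}) (w : T -> nat) (v : T).
Hypothesis (state : greedy_state D C w) (sel : selected D w v).

Local Notation u := (par v).

Lemma deeper_than_selected y : dep v < dep y -> y \in D.
Proof. by apply: contraLR => /(selected_deepest sel); rewrite -leqNgt. Qed.

Lemma selected_closed x y : x \in v |: D -> dep x < dep y -> y \in v |: D.
Proof.
rewrite !in_setU1 => /orP[/eqP-> /deeper_than_selected->|xD lt].
  by rewrite orbT.
by rewrite (deeper_treated state xD lt) orbT.
Qed.

Lemma par_untreated : u \notin D.
Proof.
apply: contra (selected_untreated sel) => uD; apply: (deeper_treated state uD).
by rewrite [dep v]dep_par ?(selected_neq_root sel).
Qed.

Lemma load_treated (F : {set T}) y : F :&: D = C ->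
  (forall z, dep y < dep z -> z \in D) -> load F y = w y.
Proof.
move=> FD; elim/leaves_up_ind: y => y IH below.
have childD z : z != root -> par z = y -> z \in D.
  by move=> zr par_z; apply: below; rewrite (dep_par zr) par_z.
rewrite loadE (weight_children state); congr (_ + _).
rewrite (eq_bigr w) => [|z /and3P[zr /eqP par_z _]]; last first.
  apply: IH => // t; rewrite (dep_par zr) par_z => lt; apply: below.
  exact: ltnW.
apply: eq_bigl => z; rewrite /uncut /= -FD !inE.
have [par_z|] := eqVneq (par z) y; rewrite ?andbF //=.
have [->|zr] := eqVneq z root.
  by rewrite (negPf (root_untreated state)) !andbF.
by rewrite (childD _ zr par_z) !andbT.
Qed.

Lemma load_sibling (F : {set T}) y :
  F :&: D = C -> y != root -> par y = u -> load F y = w y.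
Proof.
move=> FD yr par_y; apply: load_treated => // z lt; apply: deeper_than_selected.
by rewrite (dep_par (selected_neq_root sel)) -par_y -dep_par.
Qed.

Lemma overweight_cut (F : {set T}) :
  q < w u + w v -> feasible F -> F :&: D = C -> v \in F.
Proof.
have [vD vr _ _] := sel; have [rD _ _ wE _] := state.
move=> over /forallP feasF FD; apply: contraLR over => vF.
rewrite -leqNgt; apply: leq_trans (feasF u).
rewrite loadE (bigD1 v) /=; last by rewrite /uncut /= vr eqxx vF.
rewrite wE -addnA leq_add2l addnC load_sibling // leq_add2l.
rewrite [leqRHS](eq_bigr w); last first.
  by move=> y /andP[/and3P[yr /eqP par_y _] _]; rewrite load_sibling.
apply: leq_sum_sub => y; rewrite /uncut /= -FD !inE => /and3P[-> yF yD].
rewrite yD andbT in yF; rewrite yF /= !andbT.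
by apply/andP; split; [apply: contraNneq rD | apply: contraNneq vD] => <-.
Qed.

Lemma greedy_cut : q < w u + w v -> greedy_state (v |: D) (v |: C) w.
Proof.
have [vD vr _ _] := sel; have [rD sCD _ wE [F [feasF FD minF]]] := state.
move=> over; split; last first.
- exists F; split=> //; rewrite setIUr FD; congr (_ :|: _); apply/setIidPr.
  by rewrite sub1set (overweight_cut over).
- move=> x; rewrite {1}wE; congr (_ + _); apply: eq_bigl => y; rewrite !inE.
  by have [->|] := eqVneq y v; rewrite ?(negPf vD) ?andbF.
- exact: selected_closed.
- exact: setUS.
by rewrite in_setU1 eq_sym negb_or vr.
Qed.

(* An untreated sibling of [v] that is not cut is at least as heavy as [v], so
   cutting it instead of [v] does not make the component of [u] heavier. If
   there is none, the part of that component below [u], together with [v],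
   weighs [w u + w v], and cutting the edge above [u] isolates it. *)
Lemma feasible_keeping_selected (F : {set T}) : w u + w v <= q ->
  feasible F -> F :&: D = C -> v \in F ->
  exists F', [/\ feasible F', F' :&: (v |: D) = C & #|F'| <= #|F|].
Proof.
move=> fits feasF FD vF; have [vD vr _ lightest] := sel.
have exchanged x : x \notin D -> x != v -> feasible (x |: F :\ v) ->
    exists F', [/\ feasible F', F' :&: (v |: D) = C & #|F'| <= #|F|].
  move=> xD xv feasF'; exists (x |: F :\ v); split=> //.
    apply/setP=> y; rewrite -FD !inE.
    have [->|_] := eqVneq y v.
      by rewrite eq_sym (negPf xv) (negPf vD) !andbF.
    by have [->|_] := eqVneq y x; rewrite ?(negPf xD) ?andbF.
  by rewrite cardsU1 [leqRHS](cardsD1 v) vF leq_add2r; case: (_ \notin _).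
case: (pickP [pred x | uncut F x u && (x \notin D)]) => [x|none] /=.
  case/andP=> /and3P[xr /eqP par_x xF] xD.
  have xv : x != v by apply: contraNneq xF => ->.
  apply: (exchanged x) => //; apply: exchange_sibling => //.
  rewrite !load_sibling //; apply: lightest => //.
  by rewrite (dep_par xr) (dep_par vr) par_x.
apply: (exchanged u); rewrite ?par_untreated ?par_neq //.
apply: exchange_parent => //; apply: leq_trans fits.
rewrite (load_sibling FD vr erefl) leq_add2r.
rewrite loadE (weight_children state) leq_add2l.
rewrite (eq_bigr w); last first.
  by move=> y /and3P[yr /eqP par_y _]; rewrite load_sibling.
apply: leq_sum_sub => y yu; have := none y; rewrite /= yu => /negbFE yD.
by case/and3P: yu => _ -> yF; rewrite -FD !inE yD (negPf yF).
Qed.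

Lemma greedy_merge w' : w u + w v <= q ->
  w' =1 [eta w with u |-> w u + w v] -> greedy_state (v |: D) C w'.
Proof.
move=> fits w'E; have [vD vr _ _] := sel.
have [rD sCD _ wE [F [feasF FD minF]]] := state.
have uv : u != v := par_neq vr.
have vC : v \notin C by apply: contra vD; exact: subsetP.
have w'_kept y : y != u -> w' y = w y by rewrite w'E /= => /negPf->.
split; last first.
- have [vF|vF] := boolP (v \in F); last first.
    exists F; split=> //; rewrite setIUr FD; apply/setUidPr/subsetP => y.
    by rewrite !inE => /andP[yF /eqP yv]; rewrite -yv yF in vF.
  have [F' [feasF' F'D le_F']] := feasible_keeping_selected fits feasF FD vF.
  by exists F'; split=> // F'' /minF; exact: leq_trans.
- move=> x; rewrite (eq_bigr w) => [|y /andP[_]]; last first.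
    rewrite !inE => /andP[_ yvD]; apply: w'_kept; apply: contraTneq yvD => ->.
    by rewrite (negPf uv) par_untreated.
  have [->|xu] := eqVneq x u; last first.
    rewrite w'_kept // wE; congr (_ + _); apply: eq_bigl => y; rewrite !inE.
    by have [->|] := eqVneq y v; rewrite // [par v == x]eq_sym (negPf xu).
  rewrite w'E /= eqxx {1}wE [in RHS](bigD1 v) /=; last by rewrite !inE !eqxx vC.
  rewrite -addnA; congr (_ + _); rewrite addnC; congr (_ + _).
  apply: eq_bigl => y; rewrite !inE.
  by have [->|] := eqVneq y v; rewrite ?(negPf vD) ?andbF ?andbT.
- exact: selected_closed.
- exact: subset_trans sCD (subsetUr _ _).
by rewrite in_setU1 eq_sym negb_or vr.
Qed.

End Selection.
End Loads.

Definition par_edge (v : T) : {set T} := [set v; par v].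

Lemma par_edge_inj : {in [set~ root] &, injective par_edge}.
Proof.
move=> x y; rewrite !inE => xr yr e.
have : x \in par_edge y by rewrite -e set21.
have : y \in par_edge x by rewrite e set21.
case/set2P=> [->//|y_par] /set2P[->//|x_par].
by have := dep_par yr; rewrite -x_par (dep_par xr) -y_par; lia.
Qed.

Section Density.
Variable G : graph T.
Hypothesis VG : vertices G = [set: T].
Hypothesis EG : edges G = par_edge @: [set~ root].

Lemma par_edge_del (C : {set T}) v : root \notin C -> v != root ->
  (par_edge v \in edges (del_edges G (par_edge @: C))) = (v \notin C).
Proof.
move=> rC vr; have vG : par_edge v \in edges G by rewrite EG imset_f // !inE.
rewrite in_setD -/(edges G) vG andbT.
congr (~~ _); apply/imsetP/idP => [[x xC e]|vC]; last by exists v.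
by rewrite (par_edge_inj _ _ e) ?inE //; apply: contraNneq rC => <-.
Qed.

Definition linked (H : graph T) : {set T} :=
  [set y | (y != root) && (par_edge y \in edges H)].

Lemma linked_ends H y :
  y \in linked H -> (y \in vertices H) && (par y \in vertices H).
Proof. by rewrite inE => /andP[_ /edge_sub]; rewrite subUset !sub1set. Qed.

Lemma card_linked H : edges H \subset edges G -> #|linked H| = #|edges H|.
Proof.
move=> sHG; rewrite -(card_in_imset (f := par_edge)) => [|x y]; last first.
  rewrite !inE => /andP[xr _] /andP[yr _].
  by apply: par_edge_inj; rewrite !inE.
apply: eq_card => e; apply/imsetP/idP => [[y]|eH].
  by rewrite inE => /andP[_ yH] ->.
have := subsetP sHG e eH; rewrite EG => /imsetP[y].
by rewrite !inE => yr ey; exists y; rewrite // inE yr -ey.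
Qed.

Lemma branches_cover (F : {set T}) H :
  {in linked H, forall y, uncut F y (par y)} ->
  vertices H \subset \bigcup_(x in vertices H :\: linked H) branch F x.
Proof.
move=> linked_uncut; apply/subsetP=> y; elim/root_down_ind: y => y IH yH.
have [yL|yL] := boolP (y \in linked H); last first.
  by apply/bigcupP; exists y; rewrite ?branch_refl // inE yL.
have yp := linked_uncut y yL; have /andP[_ pyH] := linked_ends yL.
have yr : y != root by case/and3P: yp.
have /bigcupP[x x_top pyx] := IH yr pyH.
by apply/bigcupP; exists x => //; exact: branch_down yp pyx.
Qed.

(* A subgraph has one edge less than vertices in every component, and a
   component lies in the branch of its top vertex. *)
Lemma feasible_sparse (C : {set T}) p q H : root \notin C ->
  feasible (q - p) q C -> subgraph H (del_edges G (par_edge @: C)) ->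
  q * #|edges H| <= p * #|vertices H|.
Proof.
move=> rC /forallP feasC /andP[_ sHGC].
have sHG : edges H \subset edges G by apply: subset_trans sHGC (subsetDl _ _).
have linked_uncut : {in linked H, forall y, uncut C y (par y)}.
  move=> y; rewrite inE => /andP[yr yH]; rewrite /uncut /= yr eqxx.
  by rewrite -par_edge_del //; exact: (subsetP sHGC).
pose tops := vertices H :\: linked H.
have card_tops : #|vertices H| = #|edges H| + #|tops|.
  rewrite -card_linked // -(cardsID (linked H)); congr (_ + _).
  by apply: eq_card => y; rewrite inE; apply: andb_idl => /linked_ends/andP[].
have total : (q - p) * #|vertices H| <= q * #|tops|.
  have covered := subset_leq_card (branches_cover linked_uncut).
  apply: leq_trans (leq_mul (leqnn _) covered) _.
  apply: leq_trans (leq_mul (leqnn _) (leq_card_bigcup _ _)) _.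
  rewrite big_distrr [q * _]mulnC -sum_nat_const.
  by apply: leq_sum => x _; exact: feasC.
have : q * #|vertices H| <= (q - p) * #|vertices H| + p * #|vertices H|.
  by rewrite -mulnDl leq_mul2r; apply/orP; right; lia.
by rewrite {1}card_tops mulnDr; lia.
Qed.

Lemma sparse_feasible (C : {set T}) p q : root \notin C ->
  (forall H, subgraph H (del_edges G (par_edge @: C)) ->
     q * #|edges H| <= p * #|vertices H|) ->
  feasible (q - p) q C.
Proof.
move=> rC sparse; apply/forallP=> x; pose B := branch C x.
have xB : x \in B by exact: branch_refl.
have up y : y \in B :\ x -> uncut C y (par y) /\ par y \in B.
  by rewrite in_setD1 => /andP[yx yB]; exact: branch_up.
have wfB : wf_graph (B, par_edge @: (B :\ x)).
  apply/forall_inP=> e /imsetP[y yBx ->] /=.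
  have [/and3P[yr _ _] pyB] := up y yBx.
  move: yBx; rewrite in_setD1 => /andP[_ yB].
  by rewrite subUset !sub1set yB pyB cards2 [y == _]eq_sym par_neq.
have subB : subgraph (Graph wfB) (del_edges G (par_edge @: C)).
  rewrite /subgraph /vertices /= -/(vertices G) VG subsetT.
  apply/subsetP=> e /imsetP[y /up[/and3P[yr _ yC] _] ->].
  by rewrite par_edge_del.
have := sparse _ subB; rewrite /edges /vertices /= card_in_imset => [|y z].
  by rewrite /load -/B (cardsD1 x B) xB mulnBl !mulnDr !muln1; lia.
move=> /up[/and3P[yr _ _] _] /up[/and3P[zr _ _] _].
by apply: par_edge_inj; rewrite !inE.
Qed.

Lemma feasible_max_density (C : {set T}) p q : 0 < q -> root \notin C ->
  feasible (q - p) q C =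
  (max_density (del_edges G (par_edge @: C)) <= p%:R / q%:R)%R.
Proof.
move=> q_gt0 rC; apply/idP/max_density_leP => // [feasC H|]; last first.
  exact: sparse_feasible.
exact: feasible_sparse.
Qed.

Lemma card_par_edges (C : {set T}) : root \notin C -> #|par_edge @: C| = #|C|.
Proof.
rewrite -subset_setC1 => /subsetP sC; apply: card_in_imset.
exact: sub_in2 sC _ par_edge_inj.
Qed.

Lemma min_feasible_min_deletion (C : {set T}) p q : 0 < q -> root \notin C ->
  feasible (q - p) q C ->
  (forall C', feasible (q - p) q C' -> #|C| <= #|C'|) ->
  min_edge_deletion_bounded_density G (p%:R / q%:R)%R (par_edge @: C).
Proof.
move=> q_gt0 rC feasC minC; split; first split.
- by rewrite EG imsetS // subset_setC1.
- by rewrite -feasible_max_density.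
move=> F [sFG densF]; pose C' := [set v in [set~ root] | par_edge v \in F].
have FC' : F = par_edge @: C'.
  apply/setP=> e; apply/idP/imsetP => [eF|[v]]; last first.
    by rewrite inE => /andP[_ vF] ->.
  have /(subsetP sFG) := eF; rewrite EG => /imsetP[v vr ev].
  by exists v; rewrite // inE vr -ev.
have rC' : root \notin C' by rewrite !inE eqxx.
rewrite FC' in densF *; rewrite !card_par_edges //; apply: minC.
by rewrite feasible_max_density.
Qed.

End Density.
End RootedTree.

(** * Rootings of graphs *)

Section Rootings.
Variables (T : finType) (G : graph T) (root : T).

Lemma adj_sym : symmetric (adj G).
Proof. by move=> x y; rewrite /adj setUC. Qed.

(* Depth 0 marks the vertices that are not visited yet. *)
Record partial_rooting (par : T -> T) (dep : T -> nat) : Prop :=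
PartialRooting {
  root_depth : dep root = 1;
  visited_par : forall v, v != root -> 0 < dep v ->
    [/\ 0 < dep (par v), dep v = (dep (par v)).+1 & adj G v (par v)] }.

Lemma partial_rooting_visit par dep par' dep' x y :
  partial_rooting par dep -> 0 < dep x -> dep y = 0 -> adj G x y ->
  par' =1 [eta par with y |-> x] -> dep' =1 [eta dep with y |-> (dep x).+1] ->
  partial_rooting par' dep'.
Proof.
case=> dep_root visited dx dy xy par'E dep'E.
have unvisited v : 0 < dep v -> v != y by apply: contraTneq => ->; rewrite dy.
have dep'_kept v : 0 < dep v -> dep' v = dep v.
  by move=> dv; rewrite dep'E /= (negPf (unvisited v dv)).
split=> [|v vr]; first by rewrite dep'_kept dep_root.
have [->|vy] := eqVneq v y.
  by rewrite dep'E par'E /= eqxx dep'_kept // adj_sym.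
rewrite dep'E par'E /= (negPf vy) => dv; have [dp dvE vp] := visited v vr dv.
by rewrite dep'_kept.
Qed.

Definition rooting (par : T -> T) (dep : T -> nat) : Prop :=
  partial_rooting par dep /\ forall v, 0 < dep v.

Lemma rooting_exists : (forall v, connect (adj G) root v) ->
  exists par dep, rooting par dep.
Proof.
move=> conn; suff grow k par dep : partial_rooting par dep ->
    #|[set v | dep v == 0]| <= k -> exists par dep, rooting par dep.
  apply: (grow #|T| id (fun v => v == root)); last exact: max_card.
  by split=> [|v /negPf->] //; rewrite eqxx.
elim: k par dep => [|k IHk] par dep rooted.
  rewrite leqn0 cards_eq0 => /eqP none; exists par, dep; split=> // v.
  by have := in_set0 v; rewrite -none inE lt0n => ->.
have [/existsP[x /existsP[y /and3P[xy dx /eqP dy]]]|no_step] :=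
  boolP [exists x, exists y, [&& adj G x y, 0 < dep x & dep y == 0]].
  have rooted' := partial_rooting_visit rooted dx dy xy (frefl _) (frefl _).
  move=> lt_k; apply: IHk rooted' _.
  rewrite -ltnS; apply: leq_trans lt_k; apply: proper_card.
  apply/properP; split; last by exists y; rewrite !inE /= ?dy ?eqxx.
  by apply/subsetP => v; rewrite !inE /=; case: (v == y).
have visited_closed : closed (adj G) [pred v | 0 < dep v].
  apply: (intro_closed (sym_connect_sym adj_sym)) => x y xy.
  rewrite !inE lt0n => dx; apply: contraR no_step => dy.
  apply/existsP; exists x; apply/existsP; exists y.
  by rewrite xy lt0n dx -leqn0 leqNgt.
move=> _; exists par, dep; split=> // v.
have := closed_connect visited_closed (conn v); rewrite !inE => <-.
by rewrite (root_depth rooted).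
Qed.

Section Acyclic.
Variables (par : T -> T) (dep : T -> nat).
Hypothesis acyc : acyclic G.
Hypothesis rooted : rooting par dep.

Lemma rooting_par v :
  v != root -> dep v = (dep (par v)).+1 /\ adj G v (par v).
Proof.
have [partial visited] := rooted.
by move=> vr; have [] := visited_par partial vr (visited v).
Qed.

Lemma rooting_dep v : v != root -> dep v = (dep (par v)).+1.
Proof. by move=> /rooting_par[]. Qed.

Definition tree_adj : rel T :=
  [rel x y | (x != root) && (y == par x) || (y != root) && (x == par y)].

Lemma tree_adj_sym : symmetric tree_adj.
Proof. by move=> x y; rewrite /tree_adj /= orbC. Qed.

Lemma sub_tree_adj : subrel tree_adj (adj G).
Proof.
by move=> x y /orP[] /andP[vr /eqP->]; last rewrite adj_sym;
  case/rooting_par: vr.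
Qed.

Lemma tree_adj_connect x y : connect tree_adj x y.
Proof.
have to_root v : connect tree_adj v root.
  elim/(root_down_ind rooting_dep): v => v IH.
  have [->|vr] := eqVneq v root; first exact: connect0.
  by apply: connect_trans (connect1 _) (IH vr); rewrite /tree_adj /= vr eqxx.
apply: connect_trans (to_root x) _.
by rewrite (sym_connect_sym tree_adj_sym).
Qed.

(* The tree path between the endpoints of any other edge would close a cycle
   with it. *)
Lemma acyclic_edges : edges G = par_edge par @: [set~ root].
Proof.
apply/setP=> e; apply/idP/imsetP => [eG|[v]]; last first.
  by rewrite !inE => vr ->; case/rooting_par: vr.
have /eqP/cards2P[x [y [neq_xy exy]]] := card_edge eG.
have /connectP[p0 /shortenP[p tree_p uniq_p _] lastp] := tree_adj_connect x y.
have cycle_p : ucycle (adj G) (x :: p).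
  apply/andP; split=> //=; rewrite rcons_path (sub_path sub_tree_adj tree_p) /=.
  by rewrite -lastp adj_sym /adj -exy.
case: p => [|z [|t p]] in tree_p lastp cycle_p {uniq_p}.
- by rewrite lastp eqxx in neq_xy.
- move: tree_p; rewrite -[z]lastp /= andbT => /orP[] /andP[vr /eqP vp].
    by exists x; rewrite ?inE // exy vp.
  by exists y; rewrite ?inE // exy vp setUC.
by case/acyc: cycle_p.
Qed.

End Acyclic.

Lemma acyclic_card_edges : (forall v, connect (adj G) root v) -> acyclic G ->
  #|edges G| <= #|T|.
Proof.
move=> /rooting_exists[par [dep rooted]] acyc.
rewrite (acyclic_edges acyc rooted).
exact: leq_trans (leq_imset_card _ _) (max_card _).
Qed.

End Rootings.

(** * The program *)

Notation "c1 ;; c2" := (CSeq c1 c2) (at level 61, right associativity).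

(* Register 0 holds the number [n] of vertices; for tau = p / q the capacity is
   [q] and the mass of a vertex is [q - p]. *)
Definition r_round := 1.
Definition r_slot := 2.
Definition r_capacity := 3.
Definition r_mass := 4.
Definition r_zero := 5.
Definition r_one := 6.
Definition r_fst := 7.
Definition r_snd := 8.
Definition r_fst_depth := 9.
Definition r_snd_depth := 10.
Definition r_slot_depth := 11.
Definition r_slot_weight := 12.
Definition r_best := 13.
Definition r_best_depth := 14.
Definition r_best_weight := 15.
Definition r_parent := 16.
Definition r_sum := 17.
Definition r_test := 18.

(* The depth of a vertex is 0 before it is visited and after it is treated. *)
Definition a_fst := 1.
Definition a_snd := 2.
Definition a_depth := 3.
Definition a_parent := 4.
Definition a_weight := 5.

Definition setup_code : cmd :=
  CRead r_test ;; CRead r_mass ;; CRead r_capacity ;;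
  CSub r_mass r_capacity r_mass ;; CConst r_zero 0 ;; CConst r_one 1 ;;
  CStore a_depth r_zero r_one.

Definition read_edge_code : cmd :=
  CRead r_fst ;; CRead r_snd ;; CStore a_fst r_round r_fst ;;
  CStore a_snd r_round r_snd ;; CStore a_weight r_round r_mass.

Definition visit_code (r_from r_to r_from_depth : nat) : cmd :=
  CStore a_parent r_to r_from ;; CAdd r_from_depth r_from_depth r_one ;;
  CStore a_depth r_to r_from_depth.

Definition load_edge_code : cmd :=
  CLoad a_fst r_fst r_slot ;; CLoad a_snd r_snd r_slot ;;
  CLoad a_depth r_fst_depth r_fst ;; CLoad a_depth r_snd_depth r_snd.

Definition spread_code : cmd :=
  CIf r_fst_depth
    (CIf r_snd_depth CSkip (visit_code r_fst r_snd r_fst_depth))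
    (CIf r_snd_depth (visit_code r_snd r_fst r_snd_depth) CSkip).

Definition relax_code : cmd := load_edge_code ;; spread_code.

Definition rooting_code : cmd := CFor r_round (CFor r_slot relax_code).

Definition load_candidate_code : cmd :=
  CLoad a_depth r_slot_depth r_slot ;; CLoad a_weight r_slot_weight r_slot.

Definition record_best_code : cmd :=
  CAdd r_best r_slot r_zero ;; CAdd r_best_depth r_slot_depth r_zero ;;
  CAdd r_best_weight r_slot_weight r_zero.

Definition compare_code : cmd :=
  CSub r_test r_slot_depth r_best_depth ;;
  CIf r_test record_best_code
    (CSub r_test r_best_depth r_slot_depth ;;
     CIf r_test CSkip
       (CSub r_test r_best_weight r_slot_weight ;;
        CIf r_test record_best_code CSkip)).

Definition scan_code : cmd := load_candidate_code ;; compare_code.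

Definition select_code : cmd :=
  CConst r_best 0 ;; CLoad a_depth r_best_depth r_best ;;
  CLoad a_weight r_best_weight r_best ;;
  CFor r_slot scan_code.

Definition settle_code : cmd :=
  CLoad a_parent r_parent r_best ;; CLoad a_weight r_sum r_parent ;;
  CAdd r_sum r_sum r_best_weight ;; CSub r_test r_sum r_capacity ;;
  CIf r_test (CPrint r_best ;; CPrint r_parent)
             (CStore a_weight r_parent r_sum).

(* The root has depth 1 and is not settled. *)
Definition treat_code : cmd :=
  CSub r_test r_best_depth r_one ;; CIf r_test settle_code CSkip ;;
  CStore a_depth r_best r_zero.

Definition greedy_code : cmd := CFor r_round (select_code ;; treat_code).

Definition deletion_code : cmd :=
  setup_code ;; CFor r_round read_edge_code ;; rooting_code ;; greedy_code.

(** * Correctness of the program *)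

Lemma sem_setup n m p q x (s := sem n setup_code (loaded n [:: m, p, q & x])) :
  [/\ input s = x, output s = [::], reg s r_capacity = q
    & reg s r_mass = q - p] /\
  [/\ reg s r_zero = 0, reg s r_one = 1, forall i, cell s a_depth i = (i == 0)
    & forall i, cell s a_parent i = 0].
Proof. by split; split=> // i; rewrite /s /= !storeE /=; case: eqP. Qed.

Lemma sem_visit n r_x r_y r_d s (s' := sem n (visit_code r_x r_y r_d) s) :
  r_y != r_d ->
  (forall i, cell s' a_parent i =
     if i == reg s r_y then reg s r_x else cell s a_parent i) /\
  (forall i, cell s' a_depth i =
     if i == reg s r_y then reg s r_d + reg s r_one else cell s a_depth i).
Proof.
move=> /negPf neq_yd.
by split=> i; rewrite /s' /= !storeE /= ?eqxx ?neq_yd.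
Qed.

Lemma eq_set2 (T : finType) (x y a b : T) : [set x; y] = [set a; b] ->
  (x = a /\ y = b) \/ (x = b /\ y = a).
Proof.
move=> e.
have /set2P x_ab : x \in [set a; b] by rewrite -e set21.
have /set2P y_ab : y \in [set a; b] by rewrite -e set22.
have /set2P a_xy : a \in [set x; y] by rewrite e set21.
have /set2P b_xy : b \in [set x; y] by rewrite e set22.
by case: x_ab a_xy b_xy => -> [] ? [] ?; case: y_ab; auto.
Qed.

Section EdgeSlots.
Variables (n : nat) (G : graph 'I_n).

Definition slot_holds (s : store) (j : nat) (x y : 'I_n) : Prop :=
  cell s a_fst j = x /\ cell s a_snd j = y.

Record stores_edges (s : store) : Prop := StoresEdges {
  slot_adj : forall j, j < n ->
    exists x y, slot_holds s j x y /\ ((x == y) || adj G x y);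
  adj_slot : forall x y, adj G x y ->
    exists2 j, j < n & slot_holds s j x y \/ slot_holds s j y x }.

Variables (root : 'I_n) (l : seq ('I_n * 'I_n)).
Hypothesis edges_l : edge_list (edges G) l.

(* The slots are filled from [n - 1] down; as the machine reads 0 past the end
   of its input, slots without an edge hold the loop at the vertex 0. *)
Definition slot_edge (j : nat) : 'I_n * 'I_n := nth (root, root) l (n - j.+1).

Lemma slot_edges_stored s : size l <= n ->
  (forall j, j < n -> slot_holds s j (slot_edge j).1 (slot_edge j).2) ->
  stores_edges s.
Proof.
move=> le_ln filled.
have mem_edges e : (e \in edges G) = (e \in [seq [set p.1; p.2] | p <- l]).
  by rewrite (perm_mem edges_l) mem_enum.
split=> [j lt_jn|x y].
  exists (slot_edge j).1, (slot_edge j).2; split; first exact: filled.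
  rewrite /slot_edge; have [lt_l|ge_l] := ltnP (n - j.+1) (size l).
    by rewrite /adj mem_edges (map_f _ (mem_nth _ lt_l)) orbT.
  by rewrite nth_default // eqxx.
rewrite /adj mem_edges => /mapP[e el exy].
have lt_i : index e l < size l by rewrite index_mem.
have [lt_j slot_i] : n - (index e l).+1 < n /\
    n - (n - (index e l).+1).+1 = index e l.
  by split; lia.
exists (n - (index e l).+1) => //.
have := filled _ lt_j; rewrite /slot_edge slot_i nth_index //.
by case: (eq_set2 exy) => -[-> ->]; [left | right].
Qed.

Hypothesis root0 : root = 0 :> nat.

Lemma head_endpoints k :
  [/\ head 0 (endpoints (drop k l)) = (nth (root, root) l k).1,
      head 0 (behead (endpoints (drop k l))) = (nth (root, root) l k).2
    & behead (behead (endpoints (drop k l))) = endpoints (drop k.+1 l)].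
Proof.
have [lt_k|ge_k] := ltnP k (size l).
  by rewrite (drop_nth (root, root) lt_k).
by rewrite nth_default // !drop_oversize //= ?root0 // ltnW.
Qed.

Lemma read_edges_correct s (s' := sem n (CFor r_round read_edge_code) s) :
  input s = endpoints l -> forall j, j < n ->
  slot_holds s' j (slot_edge j).1 (slot_edge j).2 /\
  cell s' a_weight j = reg s r_mass.
Proof.
move=> input_s.
pose filled t j := slot_holds t j (slot_edge j).1 (slot_edge j).2 /\
  cell t a_weight j = reg s r_mass.
pose filled_from r t := [/\ reg t r_mass = reg s r_mass,
    input t = endpoints (drop (n - r) l)
  & forall j, r <= j < n -> filled t j].
suff [_ _ all_filled] : filled_from 0 s' by move=> j lt_j; exact: all_filled.
apply: sem_for_ind => //.
  by split=> // [|j]; [rewrite storeE subnn drop0 | case: leqP].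
move=> r t lt_rn counter [mass_t input_t filled_t].
have [fst_t snd_t rest_t] := head_endpoints (n - r.+1).
have step_drop : (n - r.+1).+1 = n - r by lia.
rewrite -input_t step_drop in fst_t snd_t rest_t; split=> //.
move=> j /andP[le_rj lt_jn].
rewrite /filled /slot_holds /= !storeE /= counter mass_t fst_t snd_t.
have [->//|neq_jr] := eqVneq j r.
by apply: filled_t; lia.
Qed.

End EdgeSlots.

Section RootingPhase.
Variables (n : nat) (G : graph 'I_n) (root : 'I_n).

Definition parent_of (s : store) (v : 'I_n) : 'I_n :=
  insubd root (cell s a_parent v).

Definition depth_of (s : store) (v : 'I_n) : nat := cell s a_depth v.

Definition visited (s : store) (i : nat) : bool := 0 < cell s a_depth i.

Record rooting_state (s : store) : Prop := RootingState {
  edges_stored : stores_edges G s;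
  one_stored : reg s r_one = 1;
  parents_valid : forall v : 'I_n, cell s a_parent v < n;
  stored_rooting : partial_rooting G root (parent_of s) (depth_of s) }.

Lemma parent_ofE s (v : 'I_n) :
  rooting_state s -> cell s a_parent v = parent_of s v.
Proof. by move=> state; rewrite val_insubd (parents_valid state). Qed.

Lemma rooting_state_put s i v :
  i != r_one -> rooting_state s -> rooting_state (put s 0 i v).
Proof.
move=> neq_i [[slots slots'] one parents rooted]; split=> //.
by rewrite cell_put eq_sym (negPf neq_i).
Qed.

Lemma visit_correct s (x y : 'I_n) r_x r_y r_d
    (s' := sem n (visit_code r_x r_y r_d) s) :
  rooting_state s -> adj G x y -> visited s x -> ~~ visited s y ->
  reg s r_x = x -> reg s r_y = y -> reg s r_d = depth_of s x ->
  r_y != r_d -> r_d != r_one ->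
  [/\ rooting_state s', visited s' y & forall i, visited s i -> visited s' i].
Proof.
move=> state xy x_vis y_new reg_x reg_y reg_d neq_yd neq_d1.
have [[slots slots'] one parents rooted] := state.
have [parent' depth'] := sem_visit n r_x s neq_yd.
rewrite -/s' reg_x reg_y reg_d one addn1 in parent' depth'.
have y0 : depth_of s y = 0 by apply/eqP; rewrite -leqn0 leqNgt.
have visited' i : visited s' i = (i == y) || visited s i.
  by rewrite /visited depth'; case: eqP.
have [fst' snd'] : (forall i, cell s' a_fst i = cell s a_fst i) /\
    (forall i, cell s' a_snd i = cell s a_snd i).
  by split=> i; rewrite sem_frame.
split; [split | by rewrite visited' eqxx |
  by move=> i vi; rewrite visited' vi orbT].
- by split=> [j /slots[a [b]]|a b /slots'[j lt_j]];
    [exists a, b | exists j]; rewrite // /slot_holds fst' snd'.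
- by rewrite sem_frame //= orbF eq_sym.
- by move=> v; rewrite parent'; case: ifP.
apply: (partial_rooting_visit rooted x_vis y0 xy) => v.
  rewrite /parent_of parent' /= (inj_eq val_inj).
  by case: eqP => // _; rewrite valKd.
by rewrite /depth_of depth' /= (inj_eq val_inj).
Qed.

Lemma load_edge_correct s (s' := sem n load_edge_code s) (x y : 'I_n) :
  rooting_state s -> slot_holds s (reg s r_slot) x y ->
  (rooting_state s' /\ visited s' =1 visited s) /\
  [/\ reg s' r_fst = x, reg s' r_snd = y, reg s' r_fst_depth = depth_of s' x
    & reg s' r_snd_depth = depth_of s' y].
Proof.
move=> state [fst snd].
have s'E : s' = put (put (put (put s 0 r_fst x) 0 r_snd y)
    0 r_fst_depth (depth_of s x)) 0 r_snd_depth (depth_of s y).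
  by rewrite /depth_of -fst -snd.
by rewrite s'E; split; split=> //; do !apply: rooting_state_put.
Qed.

Definition relaxed (s s' : store) (x y : nat) : Prop :=
  [/\ rooting_state s', forall i, visited s i -> visited s' i
    & visited s x || visited s y -> visited s' x && visited s' y].

Lemma spread_correct s (x y : 'I_n) : rooting_state s ->
  reg s r_fst = x -> reg s r_snd = y ->
  reg s r_fst_depth = depth_of s x -> reg s r_snd_depth = depth_of s y ->
  (x == y) || adj G x y -> relaxed s (sem n spread_code s) x y.
Proof.
move=> state fst snd fst_d snd_d xy; rewrite /= fst_d snd_d -!/(visited s _).
have [|x_new] := boolP (visited s x); have [|y_new] := boolP (visited s y).
- by move=> y_vis x_vis; split=> //; rewrite x_vis y_vis.
- move=> x_vis; have adj_xy : adj G x y.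
    by case/orP: xy => // /eqP e; rewrite e (negPf y_new) in x_vis.
  have [state' y_vis mono] :=
    visit_correct state adj_xy x_vis y_new fst snd fst_d isT isT.
  by split=> // _; rewrite mono.
- move=> y_vis; have adj_yx : adj G y x.
    rewrite adj_sym; case/orP: xy => // /eqP e.
    by rewrite -e (negPf x_new) in y_vis.
  have [state' x_vis mono] :=
    visit_correct state adj_yx y_vis x_new snd fst snd_d isT isT.
  by split=> // _; rewrite x_vis mono.
by split=> //; rewrite (negPf x_new) (negPf y_new).
Qed.

Lemma relax_correct s (s' := sem n relax_code s) :
  rooting_state s -> reg s r_slot < n ->
  relaxed s s' (cell s a_fst (reg s r_slot)) (cell s a_snd (reg s r_slot)).
Proof.
move=> state lt_slot.
have [x [y [xy_slot xy]]] := slot_adj (edges_stored state) lt_slot.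
have [[state_t vis] [fst snd fst_d snd_d]] := load_edge_correct state xy_slot.
have [state' mono both] := spread_correct state_t fst snd fst_d snd_d xy.
by case: xy_slot => -> ->; split=> [//|i|]; rewrite -!vis;
  [exact: mono | exact: both].
Qed.

Lemma rooting_round_correct s (s' := sem n (CFor r_slot relax_code) s) :
  rooting_state s ->
  [/\ rooting_state s', forall i, visited s i -> visited s' i
    & forall x y, adj G x y -> visited s x -> visited s' y].
Proof.
move=> state.
pose relaxed_from r t :=
  [/\ rooting_state t, forall i, visited s i -> visited t i
  & forall j, r <= j < n ->
      visited s (cell t a_fst j) || visited s (cell t a_snd j) ->
      visited t (cell t a_fst j) && visited t (cell t a_snd j)].
have [state' mono spread] : relaxed_from 0 s'.
  apply: sem_for_ind => // [|r t lt_rn counter [state_t mono_t spread_t]|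
    r t v [state_t mono_t spread_t]].
  - by split=> [|//|j]; [exact: rooting_state_put | case: leqP].
  - have := relax_correct state_t; rewrite counter => /(_ lt_rn).
    case=> state_t' mono_t' spread_r.
    split=> [//|i /mono_t|j /andP[le_rj lt_jn]]; first exact: mono_t'.
    rewrite !sem_frame //; have [->|neq_jr] := eqVneq j r.
      by move=> vis; apply: spread_r; case/orP: vis => /mono_t->; rewrite ?orbT.
    have lt_rj : r < j < n by lia.
    by move=> vis; case/andP: (spread_t j lt_rj vis) => /mono_t'-> /mono_t'->.
  by split=> //; exact: rooting_state_put.
split=> // x y xy x_vis.
have [j lt_jn holds] := adj_slot (edges_stored state') xy.
have := spread j lt_jn.
by case: holds => -[-> ->]; rewrite x_vis ?orbT => /(_ isT)/andP[].
Qed.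

Lemma rooting_correct s (s' := sem n rooting_code s) : rooting_state s ->
  (forall v, connect (adj G) root v) ->
  rooting_state s' /\ forall v : 'I_n, visited s' v.
Proof.
move=> state conn.
have root_visited t : rooting_state t -> visited t root.
  by move=> /stored_rooting/root_depth; rewrite /visited /depth_of => ->.
pose reached r t := rooting_state t /\ forall p : seq 'I_n, size p <= n - r ->
  path (adj G) root p -> visited t (last root p).
have [state' all_reached] : reached 0 s'.
  apply: sem_for_ind => // [|r t lt_rn _ [state_t reach_t]|
    r t v [state_t reach_t]].
  - split=> [|p]; first exact: rooting_state_put.
    rewrite subnn leqn0 => /nilP-> _.
    by apply: root_visited; exact: rooting_state_put.
  - have [state_t' _ spread] := rooting_round_correct state_t; split=> // p.
    case/lastP: p => [|p v]; first by rewrite root_visited.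
    rewrite size_rcons rcons_path last_rcons => size_p /andP[path_p adj_v].
    by apply: spread adj_v (reach_t _ _ path_p); lia.
  by split=> //; exact: rooting_state_put.
split=> // v; have /connectP[p0 path_p0 ->] := conn v.
case/shortenP: path_p0 => p path_p uniq_p _; apply: all_reached path_p.
rewrite subn0; have := max_card (mem (root :: p)).
by rewrite card_ord (card_uniqP uniq_p); exact: ltnW.
Qed.

End RootingPhase.

Section SelectionAndTreatment.
Variable n : nat.

Definition precedes (s : store) (i b : nat) : bool :=
  (cell s a_depth b < cell s a_depth i) ||
  (cell s a_depth b == cell s a_depth i) &&
  (cell s a_weight i < cell s a_weight b).

Definition best_cached (s : store) : Prop :=
  reg s r_best_depth = cell s a_depth (reg s r_best) /\
  reg s r_best_weight = cell s a_weight (reg s r_best).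

Definition candidate_loaded (s : store) : Prop :=
  reg s r_slot_depth = cell s a_depth (reg s r_slot) /\
  reg s r_slot_weight = cell s a_weight (reg s r_slot).

Lemma record_best_correct s (s' := sem n record_best_code s) :
  reg s r_zero = 0 -> candidate_loaded s ->
  best_cached s' /\ reg s' r_best = reg s r_slot.
Proof.
move=> zero [loaded_depth loaded_weight].
by rewrite /best_cached /s' /= !storeE /= zero !addn0.
Qed.

Lemma compare_correct s (s' := sem n compare_code s) :
  reg s r_zero = 0 -> candidate_loaded s -> best_cached s ->
  best_cached s' /\ reg s' r_best =
    if precedes s (reg s r_slot) (reg s r_best)
    then reg s r_slot else reg s r_best.
Proof.
move=> zero loaded cached.
have [[slot_d slot_w] [best_d best_w]] := (loaded, cached).
rewrite /s' /compare_code; have := record_best_correct.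
move: record_best_code => record record_correct.
rewrite /= !storeE /= slot_d slot_w best_d best_w !subn_gt0 /precedes.
case: ltngtP => _ /=; [exact: record_correct | by [] |].
by case: ifP => _; [exact: record_correct |].
Qed.

Lemma scan_correct s (s' := sem n scan_code s) :
  reg s r_zero = 0 -> best_cached s ->
  best_cached s' /\ reg s' r_best =
    if precedes s (reg s r_slot) (reg s r_best)
    then reg s r_slot else reg s r_best.
Proof.
move=> zero cached.
exact: (@compare_correct (sem n load_candidate_code s)).
Qed.

Lemma select_correct s (s' := sem n select_code s) :
  0 < n -> reg s r_zero = 0 ->
  [/\ reg s' r_best < n, best_cached s'
    & forall i, i < n -> ~~ precedes s i (reg s' r_best)].
Proof.
move=> n_gt0 zero.
pose best_from r t := [/\ reg t r_zero = 0,
  forall i, cell t a_depth i = cell s a_depth i,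
  forall i, cell t a_weight i = cell s a_weight i &
  [/\ reg t r_best < n, best_cached t
    & forall i, r <= i < n -> ~~ precedes s i (reg t r_best)]].
suff [_ _ _ [lt_b cached best]] : best_from 0 s' by [].
rewrite /s' /select_code !sem_seq.
apply: sem_for_ind => // [|r t lt_rn counter].
  by do 2!split=> //; move=> i; case: leqP.
case=> zero_t depth_t weight_t [lt_b cached best].
have [cached' best'] := scan_correct zero_t cached.
rewrite counter in best'; split=> [|i|i|]; [by rewrite sem_frame.. |].
have precedes_t i b : precedes t i b = precedes s i b.
  by rewrite /precedes !depth_t !weight_t.
rewrite precedes_t in best'; split=> //; rewrite best'; first by case: ifP.
move=> i /andP[le_ri lt_in]; have [->|neq_ir] := eqVneq i r.
  by case: ifP => [_|->] //; rewrite /precedes; lia.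
have lt_ri : r < i < n by lia.
by have := best i lt_ri; case: ifP => //; rewrite /precedes; lia.
Qed.

Lemma settle_correct s (b := reg s r_best) (u := cell s a_parent b)
    (sum := cell s a_weight u + reg s r_best_weight)
    (over := reg s r_capacity < sum)
    (s' := sem n settle_code s) :
  (forall i, cell s' a_weight i =
     if ~~ over && (i == u) then sum else cell s a_weight i) /\
  output s' = if over then output s ++ [:: b; u] else output s.
Proof.
rewrite /s' /= storeE /= subn_gt0 -/b -/u -/sum -/over.
by case: over => /=; split=> //; rewrite !storeE /= -!cats1 -?catA.
Qed.

Definition component_sum (s : store) (b : nat) : nat :=
  cell s a_weight (cell s a_parent b) + cell s a_weight b.

Record treats (s s' : store) (b : nat) : Prop := Treats {
  treats_depth : forall i,
    cell s' a_depth i = if i == b then 0 else cell s a_depth i;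
  treats_weight : forall i, cell s' a_weight i =
    if [&& 1 < cell s a_depth b, component_sum s b <= reg s r_capacity
         & i == cell s a_parent b]
    then component_sum s b else cell s a_weight i;
  treats_output : output s' =
    if (1 < cell s a_depth b) && (reg s r_capacity < component_sum s b)
    then output s ++ [:: b; cell s a_parent b] else output s }.

Lemma treat_correct s : reg s r_one = 1 -> reg s r_zero = 0 -> best_cached s ->
  treats s (sem n treat_code s) (reg s r_best).
Proof.
move=> one zero [best_d best_w].
pose t := put s 0 r_test (reg s r_best_depth - 1).
pose t' := if 1 < reg s r_best_depth then sem n settle_code t else t.
have -> : sem n treat_code s = sem n (CStore a_depth r_best r_zero) t'.
  rewrite /treat_code !sem_seq {}/t' /t; move: settle_code => settle.
  by rewrite /= one !storeE /= subn_gt0.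
have [t'_best t'_zero t'_depth] : [/\ reg t' r_best = reg s r_best,
    reg t' r_zero = 0 & forall i, cell t' a_depth i = cell s a_depth i].
  by rewrite /t'; case: ifP => _; split=> [||i]; rewrite ?sem_frame.
have [weight_t' output_t'] := settle_correct t.
have sumE : component_sum s (reg s r_best) =
    cell s a_weight (cell s a_parent (reg s r_best)) + reg s r_best_weight.
  by rewrite /component_sum best_w.
split=> [i|i|] /=; rewrite -?best_d ?sumE t'_best t'_zero !storeE /=.
- by rewrite t'_depth.
- by rewrite /t'; case: ifP => //= _; rewrite weight_t' -leqNgt.
by rewrite /t'; case: ifP => //= _; rewrite output_t'.
Qed.

Lemma greedy_step_correct s (s' := sem n (select_code ;; treat_code) s) :
  0 < n -> reg s r_one = 1 -> reg s r_zero = 0 ->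
  exists b : 'I_n, treats s s' b /\ forall i : 'I_n, ~~ precedes s i b.
Proof.
move=> n_gt0 one zero; have [lt_b cached best] := select_correct n_gt0 zero.
set t := sem n select_code s in lt_b cached best.
have frame a i : ~~ may_write a i select_code -> cell t a i = cell s a i.
  exact: sem_frame.
have [depth' weight' output'] :
    treats t (sem n treat_code t) (reg t r_best).
  by apply: treat_correct; rewrite ?frame.
have [b bE] : exists b : 'I_n, reg t r_best = b by exists (Ordinal lt_b).
rewrite bE in best depth' weight' output'.
exists b; split=> [|i]; last exact: best.
split=> [i|i|]; rewrite /s' sem_seq -/t.
- by rewrite depth' frame.
- by rewrite weight' /component_sum !frame.
by rewrite output' /component_sum !frame // sem_silent.
Qed.

End SelectionAndTreatment.

Section GreedyPhase.
Variables (n : nat) (root : 'I_n) (par : 'I_n -> 'I_n) (dep : 'I_n -> nat).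
Hypothesis dep_root : dep root = 1.
Hypothesis dep_par : forall v, v != root -> dep v = (dep (par v)).+1.

Variables (mass q : nat).

Lemma dep_gt0 v : 0 < dep v.
Proof. by have [->|/dep_par->//] := eqVneq v root; rewrite dep_root. Qed.

Definition treated (s : store) : {set 'I_n} :=
  [set v | (v != root) && (cell s a_depth v == 0)].

Definition weight_of (s : store) (v : 'I_n) : nat := cell s a_weight v.

Definition prints_cuts (s : store) : Prop :=
  exists2 l,
    greedy_state root par dep mass q (treated s) [set v in l] (weight_of s)
    & uniq l /\ output s = endpoints [seq (v, par v) | v <- l].

Record greedy_loop (r : nat) (s : store) : Prop := GreedyLoop {
  capacity_kept : reg s r_capacity = q;
  one_kept : reg s r_one = 1;
  zero_kept : reg s r_zero = 0;
  parents_kept : forall v, v != root -> cell s a_parent v = par v;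
  depth_or_treated : forall v : 'I_n,
    cell s a_depth v = 0 \/ cell s a_depth v = dep v;
  few_remaining : #|[set v : 'I_n | 0 < cell s a_depth v]| <= r;
  cuts_printed : prints_cuts s }.

Lemma greedy_loop_put r s i v : i \notin [:: r_capacity; r_one; r_zero] ->
  greedy_loop r s -> greedy_loop r (put s 0 i v).
Proof.
rewrite !inE !negb_or => /and3P[/negPf cap /negPf one /negPf zero].
by case=> *; split=> //; rewrite cell_put /= eq_sym ?cap ?one ?zero.
Qed.

Lemma greedy_loop_init s : mass <= q ->
  reg s r_capacity = q -> reg s r_one = 1 -> reg s r_zero = 0 ->
  (forall v, v != root -> cell s a_parent v = par v) ->
  (forall v : 'I_n, cell s a_depth v = dep v) ->
  (forall v, weight_of s v = mass) -> output s = [::] -> greedy_loop n s.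
Proof.
move=> le_mass cap one zero parents depths weights out; split=> //.
- by right.
- by rewrite -[leqRHS]card_ord max_card.
exists [::]; last by rewrite out.
have -> : treated s = set0.
  by apply/setP=> v; rewrite !inE depths -leqn0 leqNgt dep_gt0 andbF.
have -> : [set v in [::]] = set0 :> {set 'I_n}.
  by apply/setP=> v; rewrite !inE.
by apply: eq_greedy_state (greedy_init dep_par le_mass) => v; rewrite weights.
Qed.

Section Step.
Variables (r : nat) (s s' : store) (b : 'I_n).
Hypothesis loop : greedy_loop r.+1 s.
Hypothesis step_b : treats s s' b.
Hypothesis best : forall i : 'I_n, ~~ precedes s i b.

Lemma best_deepest (v : 'I_n) : cell s a_depth v <= cell s a_depth b.
Proof. by have := best v; rewrite /precedes negb_or -leqNgt => /andP[]. Qed.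

Lemma remaining_decreases : #|[set v : 'I_n | 0 < cell s' a_depth v]| <= r.
Proof.
have [b0|b_gt0] := posnP (cell s a_depth b).
  rewrite eq_card0 // => v; rewrite inE (treats_depth step_b).
  case: eqP => // _.
  by have := best_deepest v; rewrite b0 leqn0 => /eqP->.
rewrite -ltnS; apply: leq_trans (few_remaining loop); apply: proper_card.
apply/properP; split; last first.
  by exists b; rewrite !inE ?(treats_depth step_b) ?eqxx.
by apply/subsetP=> v; rewrite !inE (treats_depth step_b); case: eqP.
Qed.

Lemma treatedU1 : b != root -> treated s' = b |: treated s.
Proof.
move=> br; apply/setP=> v; rewrite !inE (treats_depth step_b) (inj_eq val_inj).
by have [->|] := eqVneq v b; rewrite ?br.
Qed.

Lemma live_selected : 1 < cell s a_depth b ->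
  selected root dep (treated s) (weight_of s) b.
Proof.
move=> live.
have depth_b : cell s a_depth b = dep b.
  by case: (depth_or_treated loop b) live => ->.
have untreated y : y \notin treated s -> y = root \/ cell s a_depth y = dep y.
  rewrite inE negb_and negbK => /orP[/eqP->|y0]; first by left.
  by right; case: (depth_or_treated loop y) y0 => ->.
split=> [||y /untreated[->|dy]|y /untreated[->|dy] dep_y].
- by rewrite inE negb_and -lt0n (ltnW live) orbT.
- by apply: contraTneq live => b_root; rewrite depth_b b_root dep_root.
- by rewrite dep_root -depth_b ltnW.
- by rewrite -dy -depth_b best_deepest.
- by rewrite depth_b -dep_y dep_root in live.
have := best y; rewrite /precedes dy dep_y -depth_b eqxx ltnn /= -leqNgt.
exact.
Qed.

Lemma prints_cuts_settled : cell s a_depth b <= 1 -> prints_cuts s'.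
Proof.
move=> settled; have [l state [uniq_l out]] := cuts_printed loop.
have weight' := treats_weight step_b; have output' := treats_output step_b.
rewrite ltnNge settled /= in weight' output'.
exists l; last by rewrite output'.
have -> : treated s' = treated s.
  apply/setP=> v; rewrite !inE (treats_depth step_b) (inj_eq val_inj).
  have [->|//] := eqVneq v b; have [//|br /=] := eqVneq b root.
  case: (depth_or_treated loop b) => [->//|depth_b].
  by move: settled; rewrite depth_b (dep_par br) ltnS leqNgt dep_gt0.
by apply: eq_greedy_state state => v; rewrite /weight_of weight'.
Qed.

Lemma component_sumE : b != root ->
  component_sum s b = weight_of s (par b) + weight_of s b.
Proof. by move=> br; rewrite /component_sum (parents_kept loop br). Qed.

Lemma prints_cuts_cut : 1 < cell s a_depth b ->
  q < weight_of s (par b) + weight_of s b -> prints_cuts s'.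
Proof.
move=> live over; have [l state [uniq_l out]] := cuts_printed loop.
have sel := live_selected live; have [b_untreated br _ _] := sel.
have weight' := treats_weight step_b; have output' := treats_output step_b.
rewrite live (capacity_kept loop) component_sumE // in weight' output'.
rewrite over (parents_kept loop br) /= in output'.
rewrite leqNgt over /= in weight'.
exists (rcons l b); last first.
  split; last by rewrite output' out /endpoints !map_rcons flatten_rcons.
  rewrite rcons_uniq uniq_l andbT; apply: contra b_untreated => bl.
  by apply: (subsetP (cuts_treated state)); rewrite inE.
have -> : [set v in rcons l b] = b |: [set v in l].
  by apply/setP=> v; rewrite !inE mem_rcons inE.
rewrite treatedU1 //.
apply: eq_greedy_state (greedy_cut dep_par state sel over) => v.
by rewrite /weight_of weight'.
Qed.

Lemma prints_cuts_merge : 1 < cell s a_depth b ->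
  weight_of s (par b) + weight_of s b <= q -> prints_cuts s'.
Proof.
move=> live fits; have [l state [uniq_l out]] := cuts_printed loop.
have sel := live_selected live; have br := selected_neq_root sel.
have weight' := treats_weight step_b; have output' := treats_output step_b.
rewrite live (capacity_kept loop) component_sumE // in weight' output'.
rewrite ltnNge fits /= in output'.
rewrite fits (parents_kept loop br) /= in weight'.
exists l; last by rewrite output'.
rewrite treatedU1 //; apply: (greedy_merge dep_par state sel fits) => v.
by rewrite /weight_of weight' /= (inj_eq val_inj).
Qed.

Lemma prints_cuts_step : prints_cuts s'.
Proof.
have [live|] := ltnP 1 (cell s a_depth b); last exact: prints_cuts_settled.
have [over|fits] := ltnP q (weight_of s (par b) + weight_of s b).
  exact: prints_cuts_cut.
exact: prints_cuts_merge.
Qed.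

End Step.

Lemma greedy_loop_step r s : greedy_loop r.+1 s ->
  greedy_loop r (sem n (select_code ;; treat_code) s).
Proof.
move=> loop; set s' := sem n _ s.
have frame a i : ~~ may_write a i (select_code ;; treat_code) ->
    cell s' a i = cell s a i.
  exact: sem_frame.
have n_gt0 : 0 < n by exact: leq_ltn_trans (ltn_ord root).
have [b [step_b best]] :=
  greedy_step_correct n_gt0 (one_kept loop) (zero_kept loop).
have [cap one zero parents depths _ _] := loop.
split; rewrite ?frame //.
- by move=> v vr; rewrite frame // parents.
- move=> v; rewrite (treats_depth step_b).
  by case: eqP => _; [left | exact: depths].
- exact: (remaining_decreases loop step_b best).
exact: (prints_cuts_step loop step_b best).
Qed.

Lemma greedy_code_correct s (s' := sem n greedy_code s) : greedy_loop n s ->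
  exists l, [/\ uniq l, root \notin l,
    output s' = endpoints [seq (v, par v) | v <- l],
    feasible root par mass q [set v in l]
    & forall F, feasible root par mass q F -> #|[set v in l]| <= #|F|].
Proof.
move=> loop.
have [_ _ _ _ _ none_left [l state [uniq_l out]]] : greedy_loop 0 s'.
  apply: (@sem_for_ind n r_round _ greedy_loop) => // [|r t _ _|r t v].
  - exact: greedy_loop_put.
  - exact: greedy_loop_step.
  exact: greedy_loop_put.
have all_treated v : v != root -> v \in treated s'.
  move=> vr; rewrite inE vr -leqn0 leqNgt; apply/negP=> v_left.
  move: none_left; rewrite leqn0 cards_eq0 => /eqP/setP/(_ v).
  by rewrite !inE v_left.
have [feas opt] := greedy_done state all_treated.
exists l; split=> //; apply: contra (root_untreated state) => root_l.
by apply: (subsetP (cuts_treated state)); rewrite inE.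
Qed.

Lemma encodes_par_edges (l : seq 'I_n) : uniq l -> root \notin l ->
  encodes_edges (par_edge par @: [set v in l])
    (endpoints [seq (v, par v) | v <- l]).
Proof.
move=> uniq_l root_l; exists [seq (v, par v) | v <- l] => //.
have not_root v : v \in l -> v \in [set~ root].
  by rewrite !inE; apply: contraTneq => ->.
rewrite /edge_list -map_comp; apply: uniq_perm; last 1 first.
- move=> e; rewrite mem_enum; apply/mapP/imsetP => -[v vl ->]; exists v => //.
    by rewrite inE.
  by rewrite inE in vl.
- rewrite map_inj_in_uniq // => x y /not_root xr /not_root yr.
  exact: (par_edge_inj dep_par).
exact: enum_uniq.
Qed.

End GreedyPhase.

Section DeletionCode.
Variables (n : nat) (G : graph 'I_n) (p q m : nat) (l : seq ('I_n * 'I_n)).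
Hypothesis treeG : is_tree G.
Hypothesis spanG : vertices G = [set: 'I_n].
Hypothesis edges_l : edge_list (edges G) l.

Local Notation start := (loaded n [:: m, p, q & endpoints l]).

Lemma tree_connect u v : connect (adj G) u v.
Proof. by have [[_ conn] _] := treeG; apply: conn; rewrite spanG inE. Qed.

Lemma size_edges (root : 'I_n) : size l <= n.
Proof.
have := perm_size edges_l; rewrite size_map -cardE => ->.
rewrite -[leqRHS]card_ord (acyclic_card_edges (tree_connect root)) //.
by case: treeG.
Qed.

Lemma read_phase_correct (root : 'I_n)
    (s := sem n (CFor r_round read_edge_code) (sem n setup_code start)) :
  root = 0 :> nat ->
  [/\ rooting_state G root s, forall v : 'I_n, cell s a_weight v = q - p,
      reg s r_capacity = q, reg s r_zero = 0 & output s = [::]].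
Proof.
move=> root0; rewrite {}/s.
have [[inp out cap mass] [zero one depth parent]] :=
  sem_setup n m p q (endpoints l).
set s1 := sem n setup_code _ in inp out cap mass zero one depth parent *.
have filled := read_edges_correct root0 inp.
split.
- split.
  + apply: (slot_edges_stored (root := root) edges_l (size_edges root)).
    by move=> j /filled[].
  + by rewrite sem_frame.
  + by move=> v; rewrite sem_frame // parent (leq_ltn_trans _ (ltn_ord v)).
  split=> [|v vr]; rewrite /depth_of sem_frame // depth ?root0 //.
  by rewrite -[0]root0 (inj_eq val_inj) (negPf vr).
- by move=> v; have [_ ->] := filled v (ltn_ord v).
- by rewrite sem_frame.
- by rewrite sem_frame.
by rewrite sem_silent.
Qed.

Lemma deletion_code_correct (y := output (sem n deletion_code start)) :
  0 < n -> 0 < q ->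
  exists2 F, encodes_edges F y &
    min_edge_deletion_bounded_density G (p%:R / q%:R)%R F.
Proof.
move=> n_gt0 q_gt0; pose root := Ordinal n_gt0.
have [state weight cap zero out] := @read_phase_correct root erefl.
rewrite {}/y /deletion_code !sem_seq.
set s := sem n _ (sem n setup_code _) in state weight cap zero out *.
have [state' vis] := rooting_correct state (tree_connect root).
set s' := sem n rooting_code s in state' vis *.
have one := one_stored state'.
have rooted : rooting G root (parent_of root s') (depth_of s').
  by split; [exact: stored_rooting | exact: vis].
set par := parent_of root s' in rooted; set dep := depth_of s' in rooted.
have dep_par := rooting_dep rooted.
have EG : edges G = par_edge par @: [set~ root].
  by apply: acyclic_edges rooted; case: treeG.
have init : greedy_loop root par dep (q - p) q n s'.
  apply: (greedy_loop_init (root_depth rooted.1)) => //;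
    try by rewrite sem_frame.
  - exact: leq_subr.
  - by move=> v _; rewrite (parent_ofE _ state').
  - by move=> v; rewrite /weight_of sem_frame.
  by rewrite sem_silent.
have [c [uniq_c root_c -> feas opt]] :=
  greedy_code_correct (root_depth rooted.1) dep_par init.
exists (par_edge par @: [set v in c]); first exact: (encodes_par_edges dep_par).
by apply: (min_feasible_min_deletion dep_par spanG EG); rewrite // inE.
Qed.

End DeletionCode.

Theorem theorem6 :
  exists (P : program) (f : nat -> nat),
    bigO f (fun n : nat => n ^ 3) /\
    forall (n : nat) (G : graph 'I_n) (tau : rat) (x : seq nat),
      is_tree G -> (0 <= tau)%R -> encodes_instance G tau x ->
      exists (y : seq nat) (F : {set {set 'I_n}}),
        [/\ outputs_within P x (f n) y, encodes_edges F y
          & min_edge_deletion_bounded_density G tau F].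
Proof.
exists (stand_alone deletion_code), (fun n => (time_bound n deletion_code).+1).
split; first exact: bigO_time_bound.
move=> n G tau x treeG _ [spanG [l [p [q [edges_l q_gt0 -> ->]]]]].
have n_gt0 : 0 < n.
  by have [[/set0Pn[v _] _] _] := treeG; exact: leq_ltn_trans (ltn_ord v).
have [F F_encoded F_min] :=
  deletion_code_correct p #|edges G| treeG spanG edges_l n_gt0 q_gt0.
eexists; exists F; split; [|exact: F_encoded | exact: F_min].
exact: stand_alone_outputs_within.
Qed.
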